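(* Let $n\ge 1$ be the maximum number of users and let $\mathcal{L}=\mathrm{span}(b_1,\dots,b_m)$ be the family of resource cost functions generated by convex, nondecreasing basis functions $b_1,\dots,b_m$ (all linear combinations of the $b_j$ with nonnegative coefficients). The following statements hold. (i) Let $T^{\rm lin}$ be a Pareto optimal rule in the set of all linear taxation rules. Then $T^{\rm lin}$ is Pareto optimal over all (possibly nonlinear) local taxation rules. (ii) For each $j=1,\dots,m$ let $(F^{\rm PoA}_j,\rho^{\rm PoA}_j)$, with $F^{\rm PoA}_j:\{1,\dots,n\}\to\mathbb{R}$ and $\rho^{\rm PoA}_j\in\mathbb{R}$, be a solution of the linear program $$\begin{aligned}\underset{F,\rho}{\text{maximize}}\quad & \rho\\ \text{subject to}\quad & b_j(y)y-\rho\, b_j(x)x+F(x)(x-z)-F(x+1)(y-z)\ge 0,\quad \forall (x,y,z)\in\mathcal{I}(n),\end{aligned}$$ where $\mathcal{I}(n)=\{(x,y,z)\in\{0,1,\dots,n\}^3 : 1\le x+y-z\le n,\ z\le\min\{x,y\}\}$ and $b_j(0)=F(0)=F(n+1)=0$. Let $T^{\rm PoA}$ be the local taxation rule given, for $\ell=\sum_{j=1}^m\alpha_j b_j$ with $\alpha_j\ge 0$, by $T^{\rm PoA}(\ell)=\sum_{j=1}^m\alpha_j\tau^{\rm PoA}_j$ where $\tau^{\rm PoA}_j(x)=F^{\rm PoA}_j(x)-b_j(x)$ for $x\in\{1,\dots,n\}$ (this rule minimizes ${\rm PoA}(\mathcal{G}^n_T)$ over all local taxation rules $T$). Then ${\rm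 PoS}(\mathcal{G}^n_{T^{\rm PoA}})={\rm PoA}(\mathcal{G}^n_{T^{\rm PoA}})$. Furthermore, the functions $F^{\rm PoA}_j$, $j=1,\dots,m$, are nondecreasing and unique up to rescaling.
   Context: A (taxed, atomic) congestion game consists of users $N$, a set of resources $\mathcal{E}$, for each user $i$ a set of feasible actions $\mathcal{A}_i\subseteq 2^{\mathcal{E}}$, and for each resource $e$ a resource cost function $\ell_e:\{1,\dots,n\}\to\mathbb{R}$ and a tax function $\tau_e:\{1,\dots,n\}\to\mathbb{R}$. For an assignment $a\in\mathcal{A}=\prod_{i\in N}\mathcal{A}_i$, let $|a|_e$ be the number of users $i$ with $e\in a_i$. The system cost is ${\rm SC}(a)=\sum_{i\in N}\sum_{e\in a_i}\ell_e(|a|_e)$ (taxes excluded), and user $i$ incurs cost $C_i(a)=\sum_{e\in a_i}[\ell_e(|a|_e)+\tau_e(|a|_e)]$. A pure Nash equilibrium is an $a^{\rm ne}\in\mathcal{A}$ with $C_i(a^{\rm ne})\le C_i(a_i,a^{\rm ne}_{-i})$ for all $a_i\in\mathcal{A}_i$, $i\in N$; ${\rm NE}(G)$ is the (always nonempty) set of pure Nash equilibria of $G$, and ${\rm MinCost}(G)=\min_{a\in\mathcal{A}}{\rm SC}(a)$. For a family $\mathcal{G}$ of games, $${\rm PoA}(\mathcal{G})=\sup_{G\in\mathcal{G}}\max_{a\in{\rm NE}(G)}\frac{{\rm SC}(a)}{{\rm MinCost}(G)},\qquad {\rm PoS}(\mathcal{G})=\sup_{G\in\mathcal{G}}\min_{a\in{\rm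 NE}(G)}\frac{{\rm SC}(a)}{{\rm MinCost}(G)}.$$ A local taxation rule is a map $T$ assigning to each $\ell\in\mathcal{L}$ a tax function $T(\ell):\{1,\dots,n\}\to\mathbb{R}$. $\mathcal{G}^n_T$ is the family of all congestion games with at most $n$ users, all resource costs $\ell_e\in\mathcal{L}$, and taxes $\tau_e=T(\ell_e)$. A local rule is linear if $T(\sum_{j}\alpha_j b_j)=\sum_{j}\alpha_j T(b_j)$ for all $\alpha_j\ge 0$. A rule $T$ is Pareto optimal in a set of rules if there is no rule $T'$ in that set with ${\rm PoA}(\mathcal{G}^n_{T'})\le{\rm PoA}(\mathcal{G}^n_T)$ and ${\rm PoS}(\mathcal{G}^n_{T'})\le{\rm PoS}(\mathcal{G}^n_T)$ with at least one of the inequalities strict.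
   Formalization: The basis functions are also assumed positive on {1,…,n} (for n=2, b=(0,1) the LP forces F=0, so PoA is infinite but PoS is at most 1 and (ii) fails) and linearly independent, so that the rule T^PoA is well defined. *)

(* Defs.v *)
From HB Require Import structures.
From mathcomp Require Import all_boot all_order all_algebra.
From mathcomp Require Import all_classical all_reals ereal.

Set Implicit Arguments.
Unset Strict Implicit.
Unset Printing Implicit Defensive.

Import Order.TTheory GRing.Theory Num.Theory.
Local Open Scope classical_set_scope.
Local Open Scope ring_scope.

(* A function f : {1, .., n} -> R is a row vector whose column i carries the
   value at i.+1.  [f \at x] is the value at x, extended by 0 outside
   {1, .., n}; in particular f \at 0 = f \at n.+1 = 0. *)
Definition value_at (R : realType) (n : nat) (f : 'rV[R]_n) (x : nat) : R :=
  if x is x'.+1 then oapp (f ord0) 0 (insub x') else 0.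

Notation "f \at x" := (value_at f x) (at level 30, x at level 8, no associativity).

Section ResourceFunctions.
Context {R : realType} {n : nat}.
Implicit Type f : 'rV[R]_n.

Definition positive f := forall x, (1 <= x <= n)%N -> 0 < f \at x.

Definition nondecreasing_rf f :=
  forall x y, (1 <= x)%N -> (x <= y)%N -> (y <= n)%N -> f \at x <= f \at y.

(* f lies below its chords: the inequality
   f(y) <= (z-y)/(z-x) f(x) + (y-x)/(z-x) f(z), with denominators cleared. *)
Definition convex_rf f :=
  forall x y z, (1 <= x)%N -> (x <= y)%N -> (y <= z)%N -> (z <= n)%N ->
    (z - x)%:R * f \at y <= (z - y)%:R * f \at x + (y - x)%:R * f \at z.

End ResourceFunctions.

Record congestion_game (R : realType) (n : nat) := CongestionGame {
  user : finType;
  resource : finType;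
  user_le : (#|user| <= n)%N;
  actions : user -> {set {set resource}};
  actions_neq0 : forall i, exists s, s \in actions i;
  rcost : resource -> 'rV[R]_n;
  rtax : resource -> 'rV[R]_n
}.

Section Game.
Context {R : realType} {n : nat} (G : congestion_game R n).

Definition profile := {ffun user G -> {set resource G}}.
Implicit Type a : profile.

Definition feasible a : bool := [forall i, a i \in actions i].

Definition load a (e : resource G) : nat := #|[pred i | e \in a i]|.

Definition system_cost a : R :=
  \sum_(i : user G) \sum_(e in a i) rcost e \at (load a e).

Definition user_cost (i : user G) a : R :=
  \sum_(e in a i) (rcost e \at (load a e) + rtax e \at (load a e)).

Definition deviate a (i : user G) (s : {set resource G}) : profile :=
  [ffun j => if j == i then s else a j].

Definition is_pure_nash a : bool :=
  feasible a &&
  [forall i, forall s in actions i, user_cost i a <= user_cost i (deviate a i s)].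

(* The minima and maxima below range over finite sets, nonempty because every
   user has an action and a pure Nash equilibrium always exists, so the default
   values +oo and -oo play no role. *)
Definition min_cost : \bar R :=
  (\big[mine/+oo]_(a : profile | feasible a) (system_cost a)%:E)%E.

(* With the division of extended reals, c / 0 = +oo for c > 0, and 0 / 0 = 0. *)
Definition cost_ratio a : \bar R := ((system_cost a)%:E / min_cost)%E.

Definition game_PoA : \bar R :=
  (\big[maxe/-oo]_(a : profile | is_pure_nash a) cost_ratio a)%E.

Definition game_PoS : \bar R :=
  (\big[mine/+oo]_(a : profile | is_pure_nash a) cost_ratio a)%E.

End Game.

(* A family of games is a predicate rather than a [set]: the record contains
   finite types, hence is too large to be the carrier of a [set]. *)
Definition game_family (R : realType) (n : nat) := congestion_game R n -> Prop.

Definition PoA (R : realType) (n : nat) (Gs : game_family R n) : \bar R :=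
  ereal_sup [set v | exists2 G, Gs G & v = game_PoA G].

Definition PoS (R : realType) (n : nat) (Gs : game_family R n) : \bar R :=
  ereal_sup [set v | exists2 G, Gs G & v = game_PoS G].

(* Only the values of a rule on the cone spanned by the basis functions
   matter: no other resource cost occurs in the games it is applied to. *)
Definition tax_rule (R : realType) (n : nat) := 'rV[R]_n -> 'rV[R]_n.

Section Rules.
Context {R : realType} {n m : nat} (b : 'I_m -> 'rV[R]_n).
Implicit Type T : tax_rule R n.

Definition comb (alpha : 'I_m -> R) (f : 'I_m -> 'rV[R]_n) : 'rV[R]_n :=
  \sum_(j < m) alpha j *: f j.

Definition cone : set 'rV[R]_n :=
  [set l | exists2 alpha : 'I_m -> R, (forall j, 0 <= alpha j) & l = comb alpha b].

Definition games T : game_family R n :=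
  fun G => forall e : resource G, cone (rcost e) /\ rtax e = T (rcost e).

Definition linear_rule : set (tax_rule R n) :=
  [set T | forall alpha : 'I_m -> R, (forall j, 0 <= alpha j) ->
     T (comb alpha b) = comb alpha (fun j => T (b j))].

Definition pareto_optimal (S : set (tax_rule R n)) T : Prop :=
  S T /\
  ~ exists T', [/\ S T',
      (PoA (games T') <= PoA (games T))%E,
      (PoS (games T') <= PoS (games T))%E &
      (PoA (games T') < PoA (games T))%E \/ (PoS (games T') < PoS (games T))%E].

End Rules.

Section LinearProgram.
Context {R : realType} {n : nat} (b : 'rV[R]_n).

Definition index_set : set (nat * nat * nat) :=
  [set t | let: (x, y, z) := t in
     [/\ (x <= n)%N, (y <= n)%N, (z <= n)%N,
         (1 <= x + y - z <= n)%N & (z <= minn x y)%N]].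

Definition lp_feasible (F : 'rV[R]_n) (rho : R) : Prop :=
  forall x y z : nat, index_set (x, y, z) ->
    0 <= b \at y * y%:R - rho * b \at x * x%:R
         + F \at x * (x%:R - z%:R) - F \at (x.+1) * (y%:R - z%:R).

Definition lp_solution (F : 'rV[R]_n) (rho : R) : Prop :=
  lp_feasible F rho /\
  forall (F' : 'rV[R]_n) (rho' : R), lp_feasible F' rho' -> rho' <= rho.

End LinearProgram.

(* T(sum_j alpha_j b_j) = sum_j alpha_j tau_j with tau_j = F_j - b_j. *)
Definition rule_of (R : realType) (n m : nat) (b F : 'I_m -> 'rV[R]_n)
    (T : tax_rule R n) : Prop :=
  forall alpha : 'I_m -> R, (forall j, 0 <= alpha j) ->
    T (comb alpha b) = comb alpha (fun j => F j - b j).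

(* Main.v *)
Require Import Defs.
From mathcomp Require Import all_boot all_order all_algebra.
From mathcomp Require Import all_classical all_reals ereal.
From mathcomp Require Import ring lra zify.
Import Order.TTheory GRing.Theory Num.Theory.
Local Open Scope classical_set_scope.
Local Open Scope ring_scope.

(** Write c(x) = b(x) x and F = b + T(b). A bound PoA(T) <= V, tested on games in
    which the users are rotated around a circle, is by one-dimensional duality the
    same as a common scaling nu >= 0 of the F_j such that
      V c_j(v + z) - c_j(u + z) + nu (F_j(u + z) u - F_j(u + z + 1) v) >= 0
    for all j and u + v + z <= n. This only involves the values of T on the basis,
    so the linear rule with the same values is at least as good. Its price of
    stability is no larger either: non-equilibria are cut out by strict
    inequalities, linear in the weights of the basis functions, so real weights can
    be approximated by integer numbers of copies.

    For (ii), every optimal F equals the greedy solution, which starts at b(1) and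
    makes F(x + 1) as large as the constraints allow; it is nondecreasing, and at
    the optimum c(z) + F(n) (n - z) = rho c(n) for some z < n. If z users are pinned
    to a shared resource of cost b and each of the others may leave it for a private
    resource costing slightly more than F(n), all users on the shared resource is
    the only equilibrium, with ratio close to 1 / rho. *)

Set Implicit Arguments.
Unset Strict Implicit.
Unset Printing Implicit Defensive.

(** * The linear program *)

Section GreedyTax.
Context {R : realType} (n : nat) (c : nat -> R).
Hypothesis n_ge1 : (1 <= n)%N.
Hypothesis c0 : c 0%N = 0.
Hypothesis c1_gt0 : 0 < c 1%N.
Hypothesis c_convex : forall x, (x.+2 <= n)%N -> c x.+1 *+ 2 <= c x + c x.+2.
Implicit Types (F : nat -> R) (r : R).

(* The constraint of the linear program at (x, y, z) = (u + z, v + z, z). *)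
Definition lp_gap F r (u v z : nat) : R :=
  c (v + z)%N - r * c (u + z)%N + F (u + z)%N * u%:R - F (u + z).+1 * v%:R.

Definition feas F r := forall u v z, (u + v + z <= n)%N -> 0 <= lp_gap F r u v z.

Definition optimal F r :=
  feas F r /\ forall F' r', feas F' r' -> r' <= r.

Let M x := c x.+1 - c x.

Lemma marginal_mono x y : (x <= y)%N -> (y < n)%N -> M x <= M y.
Proof.
move=> /subnKC <-; elim: (y - x)%N => [|k IH]; first by rewrite addn0.
rewrite addnS => lt; apply: le_trans (IH (ltnW lt)) _.
by have := c_convex lt; rewrite /M mulr2n; lra.
Qed.

Lemma marginal_ge x : (x < n)%N -> c 1%N <= M x.
Proof. by move=> lt; rewrite -[c 1%N]subr0 -c0; exact: marginal_mono. Qed.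

Lemma cost_ge_line x d : (x + d <= n)%N -> c x + d%:R * c 1%N <= c (x + d)%N.
Proof.
elim: d => [|d IH] le; first by rewrite mul0r addn0 addr0.
have := IH (ltnW (leq_trans _ le)); rewrite addnS ltnS => /(_ (leqnn _)).
have := @marginal_ge (x + d); rewrite -addnS le => /(_ isT).
by rewrite /M addnS -natr1; lra.
Qed.

Lemma cost_le_last x d : (x + d < n)%N -> c (x + d)%N <= c x + d%:R * M (x + d)%N.
Proof.
elim: d => [|d IH] lt; first by rewrite mul0r addn0 addr0.
have lt' : (x + d < n)%N by rewrite (leq_ltn_trans _ lt) // addnS.
have := IH lt'; have := @marginal_mono (x + d) (x + d.+1).
rewrite lt addnS leqnSn => /(_ isT isT); rewrite /M -natr1 => h1.
have : 0 <= (d%:R : R) by [].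
by nra.
Qed.

Lemma cost_mono x y : (x <= y)%N -> (y <= n)%N -> c x <= c y.
Proof.
move=> /subnKC <- /cost_ge_line; apply: le_trans.
by rewrite lerDl mulr_ge0 // ltW.
Qed.

Lemma cost_ge0 x : (x <= n)%N -> 0 <= c x.
Proof. by move=> le; rewrite -c0 cost_mono. Qed.

Lemma cost_gt0 x : (0 < x)%N -> (x <= n)%N -> 0 < c x.
Proof. by move=> x0 le; apply: lt_le_trans c1_gt0 (cost_mono _ _). Qed.

Lemma feas_le1 F r : feas F r -> r <= 1.
Proof.
move=> /(_ 0 0 1)%N; rewrite !add0n /lp_gap => /(_ n_ge1).
by rewrite !add0n !mulr0 subr0 addr0 -[X in X - _]mul1r -mulrBl pmulr_lge0 // subr_ge0.
Qed.

Lemma feas_F1 F r : feas F r -> F 1%N <= c 1%N.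
Proof.
move=> /(_ 0 1 0)%N; rewrite !add0n /lp_gap => /(_ n_ge1).
by rewrite !addn0 c0 !mulr0 subr0 addr0 mulr1 subr_ge0.
Qed.

Lemma optimal_ge0 F r : optimal F r -> 0 <= r.
Proof.
move=> [_ /(_ (fun=> 0) 0)]; apply => u v z le.
rewrite /lp_gap !mul0r !subr0 addr0; apply: cost_ge0.
by apply: leq_trans le; rewrite -addnA leq_addl.
Qed.

(** The constraint at [(0, v, x - 1)] is the same bound with both arguments of [c] one lower.
    Raising them only enlarges the right-hand side, because marginals are nonnegative and increasing
    and [r <= 1]. *)
Lemma feas_upper F r x v : feas F r -> (0 < x)%N -> (x + v <= n)%N ->
  F x * v%:R <= c (x + v)%N - r * c x.
Proof.
move=> fF; case: x => // x _ le; have r1 := feas_le1 fF.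
have := fF 0%N v x; rewrite add0n (addnC v) => /(_ (ltnW le)).
rewrite /lp_gap !add0n mulr0 addr0 (addnC v).
have := @marginal_mono x (x + v); rewrite leq_addr -addSn le => /(_ isT isT).
rewrite /M -!addSn => h h'.
have xn : (x < n)%N by apply: leq_trans le; rewrite addSn ltnS leq_addr.
have M0 : 0 <= c x.+1 - c x by apply: le_trans (marginal_ge xn); exact: ltW.
have : r * (c x.+1 - c x) <= c x.+1 - c x by rewrite ler_piMl.
move: h h'; rewrite !addSn; lra.
Qed.

(* Each [Fs x.+1] is raised to the first constraint it meets. *)
Definition greedy Fs r :=
  (forall u v z, (0 < v)%N -> (u + v + z <= n)%N -> 0 <= lp_gap Fs r u v z) /\
  (forall x, (x < n)%N -> exists u v z,
     [/\ (u + z = x)%N, (0 < v)%N, (u + v + z <= n)%N & lp_gap Fs r u v z = 0]).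

Lemma greedy_exists r : exists Fs, greedy Fs r.
Proof.
(* A pair [p] is [(v, z)], with [u = x - z]; [val x f p] is the upper bound that this constraint
   puts on the value at [x.+1] when the value at [x] is [f]. *)
pose P x (p : 'I_n.+1 * 'I_n.+1) := [&& (p.2 <= x), (0 < p.1) & (x + p.1 <= n)]%N.
pose val x f (p : 'I_n.+1 * 'I_n.+1) : R :=
  (c (p.1 + p.2)%N - r * c x + f * (x - p.2)%:R) / p.1%:R.
pose p0 : 'I_n.+1 * 'I_n.+1 := (inord 1, ord0).
pose am x f := [arg min_(p < p0 | P x p) val x f p]%O.
pose fix Fs x : R := if x is x'.+1 then val x' (Fs x') (am x' (Fs x')) else 0.
have Pp0 x : (x < n)%N -> P x p0.
  by move=> lt; rewrite /P /= inordK // addn1.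
exists Fs; split.
- move=> u v z v0 le.
  have lt : (u + z < n)%N by lia.
  have vn : (v < n.+1)%N by lia.
  have zn : (z < n.+1)%N by lia.
  have Pp : P (u + z)%N (Ordinal vn, Ordinal zn) by apply/and3P => /=; split; lia.
  rewrite /lp_gap [Fs _.+1]/=.
  rewrite /am; case: arg_minP => [|p _ /(_ _ Pp)]; first exact: Pp0.
  rewrite {2}/val /= addnK ler_pdivlMr ?ltr0n // => h.
  by rewrite subr_ge0.
- move=> x lt; rewrite /lp_gap.
  have : exists2 p, P x p & Fs x.+1 = val x (Fs x) p.
    rewrite /= /am; case: arg_minP => [|p Pp _]; first exact: Pp0.
    by exists p.
  case=> -[v z] /and3P[/= zx v0 le] eF.
  exists (x - z)%N, v, z; rewrite subnK //; split => //; first by lia.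
  rewrite eF /val /= divfK ?subrr // pnatr_eq0 -lt0n //.
Qed.

Section Greedy.
Variables (F Fs : nat -> R) (r : R).
Hypothesis fF : feas F r.
Hypothesis gFs : greedy Fs r.

(** Induction on [x]: in the constraint that is tight for [Fs x.+1], the value at [x] has
    coefficient [u >= 0], so a smaller value at [x] gives a smaller bound at [x.+1]. *)
Lemma greedy_max x : (0 < x)%N -> (x <= n)%N -> F x <= Fs x.
Proof.
elim: x => // x IH _ lt; have [u [v [z [ux v0 le]]]] := gFs.2 _ lt.
have := fF le; rewrite /lp_gap ux => h h'.
have : 0 < (v%:R : R) by rewrite ltr0n.
have [u0|u0] := posnP u.
  by rewrite u0 mulr0 in h h'; nra.
have /IH/(_ (ltnW lt)) : (0 < x)%N by lia.
have : 0 <= (u%:R : R) by [].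
by nra.
Qed.

(** Constraints with [v = 0] bound the function only from below, and [Fs] dominates the feasible
    [F]. *)
Lemma greedy_feas : feas Fs r.
Proof.
move=> u v z le; have [v0|v0] := posnP v; last exact: gFs.1.
have := fF le; rewrite v0 /lp_gap !mulr0 !subr0.
have [->|u0] := posnP u; first by rewrite !mulr0.
have := @greedy_max (u + z) _ _; rewrite addn_gt0 u0 => /(_ isT).
have -> : (u + z <= n)%N by lia.
move=> /(_ isT); have : 0 <= (u%:R : R) by [].
by nra.
Qed.

(** At [x = 0] the tight constraint reads [Fs 1 * v = c v], and convexity gives [c v >= v * c 1]. *)
Lemma greedy_1 : Fs 1%N = c 1%N.
Proof.
apply/le_anti/andP; split; first exact: feas_F1 greedy_feas.
have [u [v [z [uz v0 le]]]] := gFs.2 _ n_ge1.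
have [-> ->] : u = 0%N /\ z = 0%N by lia.
have /cost_ge_line : (0 + v <= n)%N by lia.
rewrite /lp_gap !addn0 add0n c0 !mulr0 subr0 addr0.
have : 0 < (v%:R : R) by rewrite ltr0n.
by nra.
Qed.

Lemma greedy_incr x : (0 < x)%N -> (x < n)%N -> Fs x <= Fs x.+1.
Proof.
move=> x0 lt; have [u [v [z [uz v0 le]]]] := gFs.2 _ lt.
rewrite /lp_gap uz => h.
have v0' : 0 < (v%:R : R) by rewrite ltr0n.
(* By tightness this is [v * (Fs x.+1 - Fs x)]. For [v <= u] it is the gap at [(u - v, 0, z + v)];
   otherwise [feas_upper] applies with [v - u]. *)
suff : 0 <= c (v + z)%N - r * c x + Fs x * (u%:R - v%:R) by nra.
have [vu|/ltnW uv] := leqP v u.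
  have := greedy_feas (u := (u - v)%N) (v := 0%N) (z := (z + v)%N).
  rewrite /lp_gap mulr0 subr0 addn0 add0n natrB // (addnC z v).
  have -> : (u - v + (v + z))%N = x by lia.
  by rewrite (ltnW lt) => /(_ isT).
have := @feas_upper Fs r x (v - u) greedy_feas x0.
rewrite natrB //.
have -> : (x + (v - u) = v + z)%N by lia.
have -> : (v + z <= n)%N by lia.
by move=> /(_ isT); nra.
Qed.

Lemma greedy_mono x y : (0 < x)%N -> (x <= y)%N -> (y <= n)%N -> Fs x <= Fs y.
Proof.
move=> x0 /subnKC <-; elim: (y - x)%N => [|k IH]; first by rewrite addn0.
rewrite addnS => lt; apply: le_trans (IH (ltnW lt)) (greedy_incr _ lt).
by rewrite addn_gt0 x0.
Qed.

End Greedy.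

Lemma optimal_tight F r : optimal F r ->
  exists u z, [/\ (0 < u)%N, (u + z <= n)%N & lp_gap F r u 0 z = 0].
Proof.
move=> [fF oF]; have r1 := feas_le1 fF; apply: contrapT => noT.
have slack u z : (0 < u)%N -> (u + z <= n)%N -> 0 < lp_gap F r u 0 z.
  move=> u0 le; rewrite lt_neqAle fF ?addn0 // andbT.
  by apply/eqP => e; apply: noT; exists u, z.
(* At [r = 1], slackness at [(1, 0, 0)] would say [F 1 > c 1]. *)
have {r1} r1 : r < 1.
  rewrite lt_neqAle r1 andbT; apply/eqP => re.
  have := slack 1%N 0%N isT; rewrite addn0 => /(_ n_ge1).
  rewrite /lp_gap re !add0n !addn0 c0 mulr0 mulr1 => h.
  by have := feas_F1 fF; lra.
(* If all these constraints were slack, lowering [F] by [s * g], where [g] grows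
   fast enough for the constraints with [0 < v], would leave room for [r + s]. *)
pose g x : R := (n.+1 ^ x)%:R * c n.
have cn0 : 0 < c n by apply: cost_gt0.
have g_ge x : c n <= g x by rewrite ler_peMl ?ler1n ?expn_gt0 // ltW.
have gS x : g x.+1 = (n%:R + 1) * g x by rewrite /g expnS natrM -natr1 mulrA.
have g_mono x y : (x <= y)%N -> g x <= g y.
  by move=> le; rewrite /g ler_pM2r // ler_nat leq_pexp2l.
pose D := c n + g n * n%:R.
have n0 : 0 < (n%:R : R) by rewrite ltr0n.
have D0 : 0 < D by have := g_ge n; rewrite /D; nra.
(* [D] bounds [c x + g x * u], the loss per unit of [s] when [v = 0]. The cap [1 - r] keeps
   [r + s <= 1], as the constraints with [u = v = 0] require. *)
pose s := \big[Num.min/1 - r]_(p : 'I_n.+1 * 'I_n.+1 | (0 < p.1)%N && (p.1 + p.2 <= n)%N)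
   (lp_gap F r p.1 0 p.2 / D).
have s0 : 0 < s.
  rewrite /s; elim/big_ind: _ => [|x y x0 y0|[u z] /= /andP[u0 le]].
  - by rewrite subr_gt0.
  - by rewrite lt_min x0.
  - by rewrite divr_gt0 // slack.
have s_le u z : (0 < u)%N -> (u + z <= n)%N -> s * D <= lp_gap F r u 0 z.
  move=> u0 le; rewrite -ler_pdivlMr //.
  have un : (u < n.+1)%N by lia.
  have zn : (z < n.+1)%N by lia.
  by apply: (bigmin_le_cond _ (j := (Ordinal un, Ordinal zn))); rewrite /= u0.
have s1 : s <= 1 - r by exact: bigmin_le_id.
suff /oF : feas (fun x => F x - s * g x) (r + s) by lra.
move=> u v z le.
have -> : lp_gap (fun x => F x - s * g x) (r + s) u v z =
  lp_gap F r u v z - s * (c (u + z)%N + g (u + z)%N * u%:R - g (u + z).+1 * v%:R).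
  by rewrite /lp_gap; ring.
have x_le : (u + z <= n)%N by lia.
have cx := cost_mono x_le (leqnn n).
have u_le : (u%:R : R) <= n%:R by rewrite ler_nat; lia.
have u_ge : 0 <= (u%:R : R) by [].
have gx := g_ge (u + z)%N.
have gxn := g_mono _ _ x_le.
have [v0|v0] := posnP v.
  have [u0|u0] := posnP u.
    rewrite v0 u0 /lp_gap !add0n !mulr0 !subr0 !addr0.
    have := @cost_ge0 z; have -> : (z <= n)%N by lia.
    by move=> /(_ isT); nra.
  have := s_le u z u0 x_le; rewrite v0 mulr0 subr0 /D => h.
  have : c (u + z)%N + g (u + z)%N * u%:R <= c n + g n * n%:R.
    by apply: lerD => //; apply: ler_pM => //; lra.
  by nra.
(* For [0 < v], [g (u + z).+1 * v >= (n + 1) * g (u + z) >= g (u + z) * u + c n], so lowering [F]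
   pays for the larger [r]. *)
have := fF _ _ _ le; rewrite gS.
have v1 : 1 <= (v%:R : R) by rewrite ler1n.
have h1 : g (u + z)%N * u%:R <= g (u + z)%N * n%:R by rewrite ler_wpM2l //; lra.
have h2 : (n%:R + 1) * g (u + z)%N <= (n%:R + 1) * g (u + z)%N * v%:R.
  by rewrite ler_peMr //; nra.
by nra.
Qed.

Lemma greedy_tight_last Fs F r :
  feas F r -> greedy Fs r -> optimal Fs r ->
  exists2 z, (z < n)%N & c z + Fs n * (n - z)%:R = r * c n.
Proof.
move=> fF gFs oFs; have fFs := oFs.1; have r1 := feas_le1 fF; have r0 := optimal_ge0 oFs.
have [u [z [u0 le eq]]] := optimal_tight oFs.
(* Tightness at [(u, 0, z)] passes on to [(u.+1, 0, z)]. *)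
suff H k : (u + k + z <= n)%N -> lp_gap Fs r (u + k) 0 z = 0.
  exists z; first by lia.
  have := H (n - z - u)%N; have -> : (u + (n - z - u) + z = n)%N by lia.
  move=> /(_ (leqnn n)); rewrite /lp_gap.
  have -> : (u + (n - z - u) = n - z)%N by lia.
  by rewrite subnK; [rewrite add0n; lra | lia].
elim: k => [|k IH] lek; first by rewrite addn0.
have {}IH := IH (ltac:(lia)).
move: IH; set w := (u + k)%N => IH.
have xlt : (w + z < n)%N by lia.
have w0 : (0 < w)%N by lia.
have w0' : 0 < (w%:R : R) by rewrite ltr0n.
(* For [z = 0], tightness and the constraint at [(w, 1, 0)] give [Fs w.+1 <= c 1 = Fs 1]; for
   [0 < z], tightness is compared with the constraint at [(w + 1, 1, z - 1)]. *)
have Fle : Fs (w + z).+1 <= Fs (w + z)%N.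
  have [z0|z0] := posnP z.
    have := fFs w 1%N 0%N; have -> : (w + 1 + 0 <= n)%N by lia.
    move=> /(_ isT).
    move: IH; rewrite z0 /lp_gap !addn0 c0 mulr0 mulr1 => IH.
    have /(_ w) := greedy_mono fF gFs (isT : (0 < 1)%N).
    rewrite w0 (greedy_1 fF gFs) => /(_ isT).
    have -> : (w <= n)%N by lia.
    by move=> /(_ isT); lra.
  have := fFs w.+1 1%N z.-1.
  have -> : (w.+1 + 1 + z.-1 <= n)%N by lia.
  move=> /(_ isT); move: IH; rewrite /lp_gap.
  have -> : (w.+1 + z.-1 = w + z)%N by lia.
  have -> : (1 + z.-1 = z)%N by lia.
  by rewrite add0n mulr0 mulr1 -natr1; lra.
have Fge := greedy_incr fF gFs (_ : (0 < w + z)%N) xlt.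
have {Fle Fge}Fe : Fs (w + z).+1 = Fs (w + z)%N.
  by apply/le_anti; rewrite Fle Fge // addn_gt0 w0.
have le0 : 0 <= lp_gap Fs r w.+1 0 z by apply: fFs; lia.
rewrite addnS -/w; move: IH le0; rewrite /lp_gap addSn !add0n !mulr0 !subr0 Fe -natr1 => IH le0.
have := @cost_le_last z w; rewrite addnC xlt /M => /(_ isT).
have := @cost_mono z (w + z); rewrite leq_addl (ltnW xlt) => /(_ isT isT).
have := cost_ge0 (_ : (z <= n)%N); have -> : (z <= n)%N by lia.
move=> /(_ isT) cz czw cl.
(* After multiplication by [w], tightness gives [Fs (w + z) * w = r * c (w + z) - c z <= r * (c (w +
   z) - c z)], and convexity bounds the increments from [z] to [w + z] by the next marginal. *)
suff : Fs (w + z)%N <= r * (c (w + z).+1 - c (w + z)%N) by lra.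
rewrite -(ler_pM2r w0').
have : r * (c (w + z)%N - c z) <= r * (w%:R * (c (w + z).+1 - c (w + z)%N)).
  by apply: ler_wpM2l => //; lra.
by nra.
Qed.

(** [F <= Fs] by [greedy_max]. Equality at [n] follows from the tight constraint of
    [greedy_tight_last] and then descends: in a constraint tight for [Fs x.+1] the value at [x] has
    coefficient [u], so [0 < u] yields [Fs x <= F x]. *)
Lemma optimal_greedy F Fs r : optimal F r -> greedy Fs r ->
  forall x, (0 < x)%N -> (x <= n)%N -> F x = Fs x.
Proof.
move=> [fF oF] gFs; have fFs := greedy_feas fF gFs.
have oFs : optimal Fs r by [].
have r1 := feas_le1 fF.
have [z zn Fn] := greedy_tight_last fF gFs oFs.
have le := greedy_max fF gFs.
have z0' : 0 < ((n - z)%:R : R) by rewrite ltr0n subn_gt0.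
have FnE : F n = Fs n.
  apply/le_anti; rewrite le //=.
  have := fF (n - z)%N 0%N z; rewrite addn0 subnK ?(ltnW zn) // => /(_ (leqnn n)).
  rewrite /lp_gap subnK ?(ltnW zn) // add0n mulr0 subr0 => h.
  by rewrite -(ler_pM2r z0'); lra.
(* [Fs n * (n - z)] is [r * c n - c z <= c n - c z], a sum of [n - z] marginals of which [M n.-1] is
   the largest. *)
have Fn_le : Fs n <= M n.-1.
  have nE : n = n.-1.+1 by lia.
  have := @cost_le_last z (n.-1 - z)%N.
  have -> : (z + (n.-1 - z) = n.-1)%N by lia.
  have -> : (n.-1 < n)%N by lia.
  move=> /(_ isT) => h.
  have e : ((n - z)%:R : R) = (n.-1 - z)%:R + 1 by rewrite natr1; congr (_%:R); lia.
  rewrite -(ler_pM2r z0') {1}(_ : Fs n * _ = r * c n - c z); last by lra.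
  have : r * c n <= c n by rewrite ler_piMl // cost_ge0.
  move: h; rewrite e /M -nE; lra.
suff H d x : (0 < x)%N -> (x + d = n)%N -> F x = Fs x.
  by move=> x x0 xn; apply: (H (n - x)%N) => //; rewrite subnKC.
elim: d x => [|d IH] x x0; first by rewrite addn0 => ->.
rewrite addnS -addSn => xd; have {}IH := IH x.+1 isT xd.
have xn1 : (x < n)%N by lia.
apply/le_anti; rewrite le //=; last exact: ltnW.
have [u [v [w [uz v0 lev eqt]]]] := gFs.2 _ xn1.
have [u0|u0] := posnP u; last first.
  move: eqt (fF _ _ _ lev); rewrite /lp_gap uz IH.
  have : 0 < (u%:R : R) by rewrite ltr0n.
  by nra.
move: uz lev eqt; rewrite /lp_gap u0 !add0n => -> lev eqt; rewrite mulr0 addr0 in eqt.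
have x1 : (1 + x.-1 = x)%N by lia.
(* With [u = 0] the tight constraint does not involve the value at [x]. It is compared with the
   constraint at [(1, v + 1, x - 1)] or, when [v + x = n] leaves no room, at [(1, v, x - 1)], where
   [Fn_le] closes the gap. *)
have [vx|vx] := ltnP (v + x) n.
  have lev1 : (1 + v.+1 + x.-1 <= n)%N by lia.
  move: eqt (fF _ _ _ lev1); rewrite /lp_gap x1 IH.
  have -> : (v.+1 + x.-1 = v + x)%N by lia.
  have := greedy_incr fF gFs x0 xn1.
  by rewrite mulr1 -natr1; lra.
have lev1 : (1 + v + x.-1 <= n)%N by lia.
move: eqt (fF _ _ _ lev1); rewrite /lp_gap x1 IH mulr1.
have -> : (v + x.-1 = n.-1)%N by lia.
have -> : (v + x = n)%N by lia.
have := greedy_mono fF gFs x0 (ltnW xn1) (leqnn n).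
by move: Fn_le; rewrite /M prednK //; lra.
Qed.

(** Two optimal solutions share the value [r], hence the greedy solution that both equal on
    [1, .., n]. *)
Lemma optimal_structure F r : optimal F r ->
  [/\ F 1%N = c 1%N,
      forall x y, (0 < x)%N -> (x <= y)%N -> (y <= n)%N -> F x <= F y,
      exists2 z, (z < n)%N & c z + F n * (n - z)%:R = r * c n &
      forall F' r', optimal F' r' -> forall x, (0 < x)%N -> (x <= n)%N -> F' x = F x].
Proof.
move=> oF; have [Fs gFs] := greedy_exists r.
have FE := optimal_greedy oF gFs; have fF := oF.1.
split.
- by rewrite FE // (greedy_1 fF gFs).
- move=> x y x0 xy yn; rewrite !FE // ?(leq_trans xy) ?(leq_trans x0) //.
  exact: (greedy_mono fF gFs x0 xy yn).
- rewrite FE //; apply: (greedy_tight_last fF gFs); split; first exact: greedy_feas fF gFs.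
  exact: oF.2.
- move=> F' r' oF' x x0 xn; rewrite FE //.
  have rr : r' = r.
    by apply/le_anti; rewrite (oF.2 _ _ oF'.1) (oF'.2 _ _ fF).
  by move: oF'; rewrite rr => /optimal_greedy/(_ gFs) ->.
Qed.

End GreedyTax.

(** * Equilibria and prices *)

Section ValueAt.
Context {R : realType} {n : nat}.
Implicit Types f g : 'rV[R]_n.

Lemma value_at_ord f (i : 'I_n) : f \at i.+1 = f ord0 i.
Proof. by rewrite /= valK. Qed.

Lemma value_at_S f x (lt : (x < n)%N) : f \at x.+1 = f ord0 (Ordinal lt).
Proof. exact: (value_at_ord f (Ordinal lt)). Qed.

Lemma value_at_out f x : (n < x)%N -> f \at x = 0.
Proof. by case: x => // x lt; rewrite /= insubF // ltnNge -ltnS lt. Qed.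

Lemma value_at_lin (a : R) f g x : (a *: f + g) \at x = a * f \at x + g \at x.
Proof.
case: x => [|x]; first by rewrite /= mulr0 addr0.
have [lt|ge] := ltnP x n; first by rewrite !value_at_S !mxE.
by rewrite !value_at_out // mulr0 addr0.
Qed.

Lemma value_at0 x : (0 : 'rV[R]_n) \at x = 0.
Proof.
case: x => // x; have [lt|ge] := ltnP x n; last by rewrite value_at_out.
by rewrite value_at_S mxE.
Qed.

Lemma value_atZ (a : R) f x : (a *: f) \at x = a * f \at x.
Proof. by rewrite -[a *: f]addr0 value_at_lin value_at0 addr0. Qed.

Lemma value_atD f g x : (f + g) \at x = f \at x + g \at x.
Proof. by rewrite -{1}[f]scale1r value_at_lin mul1r. Qed.

Lemma value_at_comb m (alpha : 'I_m -> R) (f : 'I_m -> 'rV[R]_n) x :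
  (comb alpha f) \at x = \sum_j alpha j * f j \at x.
Proof.
rewrite /comb; elim/big_ind2: _ => [|f1 x1 f2 x2 <- <-|j _].
- exact: value_at0.
- exact: value_atD.
- exact: value_atZ.
Qed.

Lemma value_at_row (F : nat -> R) x : (0 < x)%N -> (x <= n)%N ->
  (\row_(i < n) F i.+1) \at x = F x.
Proof. by case: x => // x _ lt; rewrite value_at_S mxE. Qed.

Lemma value_at_inj f g :
  (forall x, (0 < x)%N -> (x <= n)%N -> f \at x = g \at x) -> f = g.
Proof. by move=> e; apply/rowP => i; rewrite -!value_at_ord e. Qed.

Lemma comb_delta m (q : R) (j : 'I_m) (f : 'I_m -> 'rV[R]_n) :
  comb (fun i => q * (i == j)%:R) f = q *: f j.
Proof.
rewrite /comb (bigD1 j) //= eqxx mulr1 big1 ?addr0 // => i /negPf ->.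
by rewrite mulr0 scale0r.
Qed.

Definition total_cost f (x : nat) : R := f \at x * x%:R.

End ValueAt.

Arguments value_at : simpl never.

Section LinearProgramLink.
Context {R : realType} {n : nat} (b : 'rV[R]_n).

Lemma lp_feasible_feas (F : 'rV[R]_n) r :
  lp_feasible b F r <-> feas n (total_cost b) (value_at F) r.
Proof.
split=> fF.
  (* The zero triple lies outside [index_set]; its gap is [0]. *)
  move=> u v z le; have [e|ne] := posnP (u + v + z).
    have [-> -> ->] : [/\ u = 0, v = 0 & z = 0]%N by split; lia.
    by rewrite /lp_gap /total_cost !mulr0 !subr0 addr0.
  have := fF (u + z)%N (v + z)%N z; rewrite /index_set /lp_gap /total_cost /=.
  rewrite !natrD !mulrA; have e w : w + z%:R - z%:R = w :> R by rewrite addrK.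
  by rewrite !e; apply; split; lia.
move=> x y z [xn yn zn /andP[xyz1 xyzn]]; rewrite leq_min => /andP[zx zy].
have /fF : (x - z + (y - z) + z <= n)%N by lia.
by rewrite /lp_gap /total_cost !subnK // !natrB // !mulrA.
Qed.

Lemma lp_solution_optimal (F : 'rV[R]_n) r :
  lp_solution b F r -> optimal n (total_cost b) (value_at F) r.
Proof.
move=> [fF oF]; split; first exact/lp_feasible_feas.
(* The row drops the values of [F'] outside [1, .., n], which occur only with coefficient [0]. *)
move=> F' r' fF'; apply: (oF (\row_(i < n) F' i.+1)); apply/lp_feasible_feas.
move=> u v z le; have := fF' u v z le; rewrite /lp_gap => h; apply: (le_trans h).
rewrite le_eqVlt; apply/orP; left; apply/eqP; congr (_ + _ - _).
  have [->|u0] := posnP u; first by rewrite !mulr0.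
  by rewrite value_at_row //; lia.
have [->|v0] := posnP v; first by rewrite !mulr0.
by rewrite value_at_row //; lia.
Qed.

Lemma total_cost1_gt0 : (1 <= n)%N -> positive b -> 0 < total_cost b 1.
Proof. by move=> n1 b_pos; rewrite /total_cost mulr1; exact: b_pos. Qed.

Hypothesis b_nondecreasing : nondecreasing_rf b.
Hypothesis b_convex : convex_rf b.

Lemma total_cost_convex x : (x.+2 <= n)%N ->
  total_cost b x.+1 *+ 2 <= total_cost b x + total_cost b x.+2.
Proof.
move=> le; rewrite /total_cost; have := b_nondecreasing (isT : 0 < x.+1)%N (leqnSn _) le.
(* Convexity of [b] is available from [1] on; at [x = 0] monotonicity gives [2 * b 1 <= 2 * b 2]. *)
case: x le => [|x] le.
  by rewrite /= mulr0 add0r mulr1 mulr2n; lra.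
move=> h; have := b_convex (isT : 0 < x.+1)%N (leqnSn _) (leqnSn _) le.
have -> : (x.+3 - x.+1 = 2)%N by lia.
have -> : (x.+3 - x.+2 = 1)%N by lia.
have -> : (x.+2 - x.+1 = 1)%N by lia.
rewrite !mul1r => h2; have h3 := b_nondecreasing (isT : 0 < x.+1)%N (leqnSn _) (ltnW le).
have -> : x.+3%:R = x.+1%:R + 2 :> R by rewrite -natrD addn2.
have -> : x.+2%:R = x.+1%:R + 1 :> R by rewrite natr1.
rewrite mulr2n.
have : 0 <= (x.+1%:R : R) by [].
by nra.
Qed.

End LinearProgramLink.

(** * Potential and equilibrium inequalities *)

Section Loads.
Context {R : realType} {n : nat} (G : congestion_game R n).
Implicit Type a : profile G.

Definition others a (i : user G) (e : resource G) : nat :=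
  #|[pred j | (j != i) && (e \in a j)]|.

Lemma load_others a i e : load a e = (others a i e + (e \in a i))%N.
Proof.
by rewrite /load /others (cardD1 i) addnC inE; congr (_ + _)%N.
Qed.

Lemma others_deviate a i s e : others (deviate a i s) i e = others a i e.
Proof. by apply: eq_card => j; rewrite !inE ffunE; case: eqP. Qed.

Lemma load_deviate a i s e : load (deviate a i s) e = (others a i e + (e \in s))%N.
Proof. by rewrite (load_others _ i) others_deviate ffunE eqxx. Qed.

Lemma deviate_id a i : deviate a i (a i) = a.
Proof. by apply/ffunP => j; rewrite ffunE; case: eqP => [->|]. Qed.

Lemma feasible_deviate a i s :
  feasible a -> s \in actions i -> feasible (deviate a i s).
Proof.
move=> /forallP fa si; apply/forallP => j; rewrite ffunE.
by case: eqP => [->|_].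
Qed.

Lemma feasible_exists : exists a, feasible a.
Proof.
pose a : profile G := [ffun i => xchoose (actions_neq0 i)].
by exists a; apply/forallP => i; rewrite ffunE; exact: xchooseP.
Qed.

Lemma sum_users_resources a (f : resource G -> nat -> R) :
  \sum_(i : user G) \sum_(e in a i) f e (load a e) =
  \sum_e f e (load a e) * (load a e)%:R.
Proof.
rewrite (exchange_big_dep xpredT) //=; apply: eq_bigr => e _.
by rewrite sumr_const mulr_natr; congr (_ *+ _); apply: eq_card.
Qed.

Lemma system_costE a : system_cost a = \sum_e total_cost (rcost e) (load a e).
Proof. exact: (sum_users_resources a (fun e => value_at (rcost e))). Qed.

(** Rosenthal's potential of the taxed game. *)
Definition potential a : R :=
  \sum_e \sum_(k < load a e) (rcost e \at k.+1 + rtax e \at k.+1).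

(* The first term does not depend on the action of [i]: the potential is exact. *)
Lemma potential_user a i : potential a =
  \sum_e \sum_(k < others a i e) (rcost e \at k.+1 + rtax e \at k.+1) + user_cost i a.
Proof.
rewrite /potential /user_cost [in RHS](big_mkcond (mem (a i))) -big_split.
apply: eq_bigr => e _; rewrite (load_others a i) /=.
by case: (e \in a i) => /=; [rewrite addn1 big_ord_recr | rewrite addn0 addr0].
Qed.

(** A feasible profile of least potential admits no profitable deviation. *)
Lemma nash_exists : exists a, is_pure_nash a.
Proof.
have [a0 fa0] := feasible_exists.
have [a fa amin] : exists2 a, feasible a &
    forall a', feasible a' -> potential a <= potential a'.
  by case: (arg_minP (fun a => potential a) fa0) => a fa amin; exists a.
exists a; rewrite /is_pure_nash fa; apply/forallP => i; apply/forall_inP => s si.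
have := amin _ (feasible_deviate fa si).
rewrite (potential_user a i) (potential_user _ i).
under [X in _ <= X + _]eq_bigr => e do rewrite others_deviate.
by rewrite lerD2l.
Qed.

(* With [u], [v], [z] users of [e] only in [a], only in [a'] and in both. *)
Lemma nash_sum_le0 a a' : is_pure_nash a -> feasible a' ->
  exists u v z : resource G -> nat,
    [/\ forall e, load a e = (u e + z e)%N,
        forall e, load a' e = (v e + z e)%N,
        forall e, (u e + v e + z e <= n)%N &
        \sum_e ((rcost e + rtax e) \at (u e + z e) * (u e)%:R
                - (rcost e + rtax e) \at (u e + z e).+1 * (v e)%:R) <= 0].
Proof.
move=> /andP[fa /forallP na] /forallP fa'.
pose u e := #|[pred i | (e \in a i) && (e \notin a' i)]|.
pose v e := #|[pred i | (e \notin a i) && (e \in a' i)]|.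
pose z e := #|[pred i | (e \in a i) && (e \in a' i)]|.
have lu e : load a e = (u e + z e)%N.
  rewrite /load -(cardID [pred i | e \in a' i]) addnC.
  by congr (_ + _)%N; apply: eq_card => i; rewrite !inE // andbC.
have lv e : load a' e = (v e + z e)%N.
  rewrite /load -(cardID [pred i | e \in a i]) addnC.
  by congr (_ + _)%N; apply: eq_card => i; rewrite !inE // andbC.
exists u, v, z; split=> // [e|].
  rewrite (leq_trans _ (user_le G)) // addnAC -lu -(cardC [pred i | e \in a i]) leq_add2l.
  by apply: subset_leq_card; apply/fintype.subsetP => i; rewrite !inE => /andP[].
pose f (e : resource G) x := rcost e \at x + rtax e \at x.
have h : \sum_i user_cost i a <= \sum_i user_cost i (deviate a i (a' i)).
  by apply: ler_sum => i _; move/forall_inP: (na i); apply.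
move: h; rewrite (sum_users_resources a f).
(* A user moving to [a' i] finds the load unchanged on resources it already used and raised by one
   on the others. *)
have -> : \sum_i user_cost i (deviate a i (a' i)) =
   \sum_e (f e (load a e) * (z e)%:R + f e (load a e).+1 * (v e)%:R).
  transitivity (\sum_i \sum_(e in a' i) f e (load a e + (e \notin a i))%N).
    apply: eq_bigr => i _; rewrite /user_cost ffunE eqxx; apply: eq_bigr => e ea'.
    by rewrite load_deviate ea' (load_others a i); case: (e \in a i); rewrite !(addn0, addn1).
  rewrite (exchange_big_dep xpredT) //=; apply: eq_bigr => e _.
  rewrite (bigID (fun i => e \in a i)) /=; congr (_ + _).
    rewrite (eq_bigr (fun=> f e (load a e))); last first.
      by move=> i /andP[_ ->]; rewrite addn0.
    rewrite sumr_const mulr_natr; congr (_ *+ _).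
    by apply: eq_card => i; rewrite !inE andbC.
  rewrite (eq_bigr (fun=> f e (load a e).+1)); last first.
    by move=> i /andP[_ ->]; rewrite addn1.
  rewrite sumr_const mulr_natr; congr (_ *+ _).
  by apply: eq_card => i; rewrite !inE andbC.
rewrite -subr_le0 -sumrB; apply: le_trans.
rewrite le_eqVlt; apply/orP; left; apply/eqP; apply: eq_bigr => e _.
by rewrite /f !value_atD lu natrD; ring.
Qed.

End Loads.

(** * Bounds on the prices as inequalities between costs *)

Section CostRatios.
Context {R : realType} {n : nat}.
Local Open Scope ereal_scope.

Section OneGame.
Context (G : congestion_game R n).
Implicit Type a : profile G.
Hypothesis cost_ge0 : forall a, (0 <= system_cost a)%R.

Lemma min_cost_attained : exists2 a0 : profile G, feasible a0 &
  min_cost G = (system_cost a0)%:E /\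
  forall a, feasible a -> (system_cost a0 <= system_cost a)%R.
Proof.
have [a fa] := feasible_exists G.
have [|a0 fa0 e] := @eq_bigmin _ (\bar R) _ +oo a (@feasible R n G)
  (fun a => (system_cost a)%:E) fa; first by move=> i _; exact: leey.
exists a0 => //; split=> // a' fa'; rewrite -lee_fin -e; exact: bigmin_le_cond.
Qed.

Lemma cost_ratio_le a (V : R) : (0 <= V)%R ->
  cost_ratio a <= V%:E <->
  forall a', feasible a' -> (system_cost a <= V * system_cost a')%R.
Proof.
move=> V0; rewrite /cost_ratio; have [a0 fa0 [-> amin]] := min_cost_attained.
have h : (forall a', feasible a' -> (system_cost a <= V * system_cost a')%R) <->
    (system_cost a <= V * system_cost a0)%R.
  split=> [|le a' fa']; first exact.
  by apply: le_trans le _; rewrite ler_wpM2l // amin.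
(* When the least cost is [0], both sides say that [a] costs [0]. *)
rewrite h inver; case: eqP => [->|/eqP ne].
  rewrite mulr0; have := cost_ge0 a; rewrite le_eqVlt => /orP[/eqP <-|pos].
    by rewrite mul0e lee_fin.
  by rewrite gt0_muley ?lte_fin // leye_eq; split=> //; rewrite leNgt pos.
have p0 : (0 < system_cost a0)%R by rewrite lt_neqAle eq_sym ne cost_ge0.
by rewrite -EFinM lee_fin ler_pdivrMr.
Qed.

Lemma cost_ratio_ge0 a : 0 <= cost_ratio a.
Proof.
have [a0 _ [e _]] := min_cost_attained.
by rewrite /cost_ratio e mule_ge0 ?inve_ge0 ?lee_fin.
Qed.

Lemma game_PoS_le_PoA : game_PoS G <= game_PoA G.
Proof.
have [a na] := nash_exists G.
by apply: le_trans (bigmin_le_cond _ _ na) _; apply: le_bigmax_cond.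
Qed.

Lemma game_PoS_ge0 : 0 <= game_PoS G.
Proof. by apply/bigmin_geP; split=> // a _; exact: cost_ratio_ge0. Qed.

End OneGame.

Variable Gs : game_family R n.
Hypothesis Gs_ge0 : forall G, Gs G -> forall a : profile G, (0 <= system_cost a)%R.

Lemma PoA_leP (V : R) : (0 <= V)%R ->
  PoA Gs <= V%:E <->
  forall G, Gs G -> forall a a' : profile G, is_pure_nash a -> feasible a' ->
    (system_cost a <= V * system_cost a')%R.
Proof.
move=> V0; split=> [le G GsG a a' na fa'|h].
  have : game_PoA G <= V%:E by apply: le_trans le; apply: ereal_sup_ubound; exists G.
  by move=> /bigmax_leP[_ /(_ a na)] /(cost_ratio_le (Gs_ge0 GsG) _ V0); apply.
apply: ge_ereal_sup => _ [G GsG ->]; apply/bigmax_leP; split=> [|a na]; first exact: leNye.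
by apply/(cost_ratio_le (Gs_ge0 GsG)) => // a' fa'; apply: h.
Qed.

Lemma PoS_leP (V : R) : (0 <= V)%R ->
  PoS Gs <= V%:E <->
  forall G, Gs G -> exists2 a : profile G, is_pure_nash a &
    forall a' : profile G, feasible a' -> (system_cost a <= V * system_cost a')%R.
Proof.
move=> V0; split=> [le G GsG|h].
  have : game_PoS G <= V%:E by apply: le_trans le; apply: ereal_sup_ubound; exists G.
  move=> /bigmin_leP[|[a na /(cost_ratio_le (Gs_ge0 GsG) _ V0) le']]; last by exists a.
  by rewrite leye_eq.
apply: ge_ereal_sup => _ [G GsG ->]; have [a na le] := h _ GsG.
apply: le_trans (bigmin_le_cond _ _ na) _.
exact/(cost_ratio_le (Gs_ge0 GsG)).
Qed.

Lemma PoS_le_PoA : PoS Gs <= PoA Gs.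
Proof.
apply: ge_ereal_sup => _ [G GsG ->]; apply: le_trans (game_PoS_le_PoA G) _.
by apply: ereal_sup_ubound; exists G.
Qed.

(** Nonemptiness excludes the supremum [-oo] of the empty family. *)
Lemma PoS_ge0 : (exists G, Gs G) -> 0 <= PoS Gs.
Proof.
move=> [G GsG]; apply: le_trans (game_PoS_ge0 (Gs_ge0 GsG)) _.
by apply: ereal_sup_ubound; exists G.
Qed.

End CostRatios.

Section Rules.
Context {R : realType} {n m : nat} (b : 'I_m -> 'rV[R]_n).
Hypothesis b_pos : forall j, positive (b j).
Implicit Type T : tax_rule R n.

Lemma basis_ge0 j x : 0 <= b j \at x.
Proof.
have [x0|x0] := posnP x; first by rewrite x0.
have [le|gt] := leqP x n; last by rewrite value_at_out.
by apply/ltW/b_pos; rewrite x0.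
Qed.

Lemma total_basis_ge0 j x : 0 <= total_cost (b j) x.
Proof. by rewrite mulr_ge0 // basis_ge0. Qed.

Lemma total_cost_comb (alpha : 'I_m -> R) (f : 'I_m -> 'rV[R]_n) x :
  total_cost (comb alpha f) x = \sum_j alpha j * total_cost (f j) x.
Proof.
by rewrite /total_cost value_at_comb mulr_suml; apply: eq_bigr => j _; rewrite mulrA.
Qed.

Lemma games_ge0 T G : games b T G -> forall a : profile G, 0 <= system_cost a.
Proof.
move=> GT a; rewrite system_costE; apply: sumr_ge0 => e _.
have [[alpha a0 ->] _] := GT e; rewrite total_cost_comb.
by apply: sumr_ge0 => j _; rewrite mulr_ge0 ?total_basis_ge0.
Qed.

Lemma games_inhabited T : exists G, games b T G.
Proof.
have le : (#|(void : finType)| <= n)%N by rewrite card_void.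
by exists (@CongestionGame R n void void le (fun=> finset.set0) (fun v => match v with end)
  (fun=> 0) (fun=> 0)) => -[].
Qed.

(** The function [F_j] of the linear program that corresponds to [T]. *)
Definition taxed T j : 'rV[R]_n := b j + T (b j).

(* Smoothness: adding the constraints over all resources of a game bounds its
   cost at equilibrium, for [nu] times the equilibrium inequalities. *)
Lemma linear_PoA_le T (V nu : R) : linear_rule b T -> 0 <= V -> 0 <= nu ->
  (forall j u v z, (u + v + z <= n)%N ->
     0 <= V * total_cost (b j) (v + z) - total_cost (b j) (u + z)
          + nu * (taxed T j \at (u + z) * u%:R - taxed T j \at (u + z).+1 * v%:R)) ->
  (PoA (games b T) <= V%:E)%E.
Proof.
move=> lT V0 nu0 H; apply/(PoA_leP (@games_ge0 T)) => // G GT a a' na fa'.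
have [u [v [z [lu lv le]]]] := nash_sum_le0 na fa'.
set S := \sum_e _ => S0.
suff : 0 <= V * system_cost a' - system_cost a + nu * S by nra.
rewrite !system_costE mulr_sumr -sumrB /S mulr_sumr -big_split /=.
apply: sumr_ge0 => e _; have [[alpha a0 ->] ->] := GT e.
rewrite lu lv lT // !total_cost_comb !value_atD !value_at_comb -!big_split /=.
rewrite !mulr_sumr !mulr_suml -!sumrB mulr_sumr -big_split /=; apply: sumr_ge0 => j _.
have := mulr_ge0 (a0 j) (H j _ _ _ (le e)); rewrite /taxed !value_atD.
by congr (_ <= _); ring.
Qed.

End Rules.

(** * Games with copies of the basis functions *)

Section WeightedGames.
Context {R : realType} {n m : nat} (b : 'I_m -> 'rV[R]_n) (T : tax_rule R n).
Context (G : congestion_game R n).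
Implicit Types (a : profile G) (w : resource G -> 'I_m -> R).

(* Only the users, resources and actions of [G] matter in the weighted costs:
   resource [e] carries the basis function [b j] with weight [w e j]. *)
Definition wsystem_cost w a : R :=
  \sum_e \sum_j w e j * total_cost (b j) (load a e).

Definition wuser_cost w (i : user G) a : R :=
  \sum_(e in a i) \sum_j w e j * taxed b T j \at (load a e).

Definition wnash w a : Prop :=
  feasible a /\ forall i s, s \in actions i ->
    wuser_cost w i a <= wuser_cost w i (deviate a i s).

Lemma wsystem_cost_pair w a : wsystem_cost w a =
  \sum_(p : resource G * 'I_m) w p.1 p.2 * total_cost (b p.2) (load a p.1).
Proof. by rewrite /wsystem_cost pair_bigA. Qed.

Lemma wuser_cost_pair w i a : wuser_cost w i a =
  \sum_(p : resource G * 'I_m)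
    w p.1 p.2 * (taxed b T p.2 \at (load a p.1) *+ (p.1 \in a i)).
Proof.
rewrite /wuser_cost big_mkcond -(pair_bigA _ (fun e j =>
  w e j * (taxed b T j \at (load a e) *+ (e \in a i)))) /=.
apply: eq_bigr => e _; case: (e \in a i) => //.
by rewrite big1 // => j _; rewrite mulr0.
Qed.

Lemma wcostsP : linear_rule b T -> games b T G ->
  exists2 w, (forall e j, 0 <= w e j) &
    (forall a, system_cost a = wsystem_cost w a) /\
    (forall i a, user_cost i a = wuser_cost w i a).
Proof.
move=> lT GT.
have H (e : resource G) : exists alpha : 'I_m -> R, (forall j, 0 <= alpha j) /\
    rcost e = comb alpha b /\ rtax e = comb alpha (fun j => T (b j)).
  by have [[alpha a0 e1] e2] := GT e; exists alpha; rewrite e2 e1 lT.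
have [w wP] := choice H; exists w; first by move=> e j; exact: (wP e).1.
split=> [a|i a].
  rewrite system_costE; apply: eq_bigr => e _.
  by rewrite (wP e).2.1 total_cost_comb.
apply: eq_bigr => e _; rewrite (wP e).2.1 (wP e).2.2 !value_at_comb -big_split /=.
by apply: eq_bigr => j _; rewrite /taxed value_atD mulrDr.
Qed.

Section Copies.
Variable k : resource G -> 'I_m -> nat.

(** Integer weights become identical resources, each carrying a single basis function, so that a
    nonlinear [T] is evaluated only at the [b j]. *)
Definition copy : finType := {p : resource G * 'I_m & 'I_(k p.1 p.2)}.

Definition copy_action (s : {set resource G}) : {set copy} :=
  [set p : copy | (tag p).1 \in s]%SET.

Lemma copy_actions_neq0 i :
  exists s, s \in [set copy_action s | s in @actions R n G i]%SET.
Proof. by have [s si] := actions_neq0 i; exists (copy_action s); exact: imset_f. Qed.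

Definition copy_game : congestion_game R n :=
  CongestionGame (user_le G) copy_actions_neq0
    (fun p : copy => b (tag p).2) (fun p : copy => T (b (tag p).2)).

Definition copy_profile a : profile copy_game := [ffun i => copy_action (a i)].

Lemma copy_game_in : games b T copy_game.
Proof.
move=> p; split=> //=; exists (fun j => 1 * (j == (tag p).2)%:R) => [j|]; first by rewrite mul1r.
by rewrite comb_delta scale1r.
Qed.

Lemma copy_load a (p : copy) : load (copy_profile a) p = load a (tag p).1.
Proof. by apply: eq_card => i; rewrite !inE ffunE inE. Qed.

Lemma copy_sum (s : {pred resource G}) (f : resource G -> 'I_m -> R) :
  \sum_(p : copy | (tag p).1 \in s) f (tag p).1 (tag p).2 =
  \sum_(e in s) \sum_j (k e j)%:R * f e j.
Proof.
rewrite pair_big_dep /=.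
rewrite (eq_bigr (fun p : resource G * 'I_m => \sum_(c < k p.1 p.2) f p.1 p.2)).
  rewrite sig_big_dep /=; apply: eq_bigl => p; by rewrite !andbT.
by move=> p _; rewrite sumr_const card_ord mulr_natl.
Qed.

Let w e j : R := (k e j)%:R.

Lemma copy_system_cost a : system_cost (copy_profile a) = wsystem_cost w a.
Proof.
rewrite system_costE /wsystem_cost.
rewrite -(copy_sum predT (fun e j => total_cost (b j) (load a e))).
by apply: eq_bigr => p _; rewrite copy_load.
Qed.

Lemma copy_user_cost i a : user_cost i (copy_profile a) = wuser_cost w i a.
Proof.
rewrite /user_cost /wuser_cost.
rewrite -(copy_sum (mem (a i)) (fun e j => taxed b T j \at (load a e))).
apply: eq_big => p; first by rewrite ffunE inE.
by move=> _; rewrite copy_load /taxed value_atD.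
Qed.

Lemma copy_feasible a : feasible a -> feasible (copy_profile a).
Proof. by move=> /forallP fa; apply/forallP => i; rewrite ffunE; exact: imset_f. Qed.

Lemma copy_feasibleP (a' : profile copy_game) : feasible a' ->
  exists2 a, feasible a & a' = copy_profile a.
Proof.
move=> /forallP fa'.
have H i : exists s, s \in @actions R n G i /\ a' i = copy_action s.
  by have /imsetP[s si e] := fa' i; exists s.
have [s sP] := choice H; exists [ffun i => s i].
  by apply/forallP => i; rewrite ffunE; exact: (sP i).1.
by apply/ffunP => i; rewrite !ffunE (sP i).2.
Qed.

Lemma copy_deviate a i s :
  deviate (copy_profile a) i (copy_action s) = copy_profile (deviate a i s).
Proof. by apply/ffunP => j; rewrite !ffunE; case: ifP. Qed.

Lemma copy_nash a : feasible a -> is_pure_nash (copy_profile a) <-> wnash w a.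
Proof.
move=> fa; rewrite /is_pure_nash copy_feasible //=; split.
  move=> /forallP na; split=> // i s si.
  have /forall_inP/(_ (copy_action s) (imset_f _ si)) := na i.
  by rewrite copy_deviate !copy_user_cost.
move=> [_ na]; apply/forallP => i; apply/forall_inP => _ /imsetP[s si ->].
by rewrite copy_deviate !copy_user_cost; exact: na.
Qed.

Hypothesis b_pos : forall j, positive (b j).

Lemma copy_PoA (V : R) : 0 <= V -> (PoA (games b T) <= V%:E)%E ->
  forall a a', wnash w a -> feasible a' ->
  wsystem_cost w a <= V * wsystem_cost w a'.
Proof.
move=> V0 /(PoA_leP (games_ge0 b_pos (T := T)) V0)/(_ _ copy_game_in) H a a' na fa'.
by rewrite -!copy_system_cost; apply: H; [apply/copy_nash; case: na | exact: copy_feasible].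
Qed.

Lemma copy_PoS (V : R) : 0 <= V -> (PoS (games b T) <= V%:E)%E ->
  exists2 a, wnash w a & forall a', feasible a' ->
  wsystem_cost w a <= V * wsystem_cost w a'.
Proof.
move=> V0 /(PoS_leP (games_ge0 b_pos (T := T)) V0)/(_ _ copy_game_in)[a1 na1 H].
have /andP[/copy_feasibleP[a fa e] _] := na1; move: na1 H; rewrite e => na1 H.
exists a; first exact/copy_nash.
by move=> a' fa'; rewrite -!copy_system_cost; apply: H; exact: copy_feasible.
Qed.

End Copies.

End WeightedGames.

(** * Rounding of weights and one-dimensional duality *)

Lemma eventually_truncn_lt0 {R : realType} (I : finType) (w f : I -> R) :
  (forall i, 0 <= w i) -> \sum_i w i * f i < 0 ->
  exists N0, forall N, (N0 <= N)%N ->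
    \sum_i (Num.truncn (N%:R * w i))%:R * f i < 0.
Proof.
move=> w0; set S := \sum_i _ => S0.
pose B := \sum_i `|f i|.
have B0 : 0 <= B by apply: sumr_ge0.
exists (Num.truncn (B / - S)).+1 => N le.
have BN : B < N%:R * - S.
  rewrite -ltr_pdivrMr ?oppr_gt0 //; apply: lt_le_trans (truncnS_gt _) _.
  by rewrite ler_nat.
have : \sum_i (Num.truncn (N%:R * w i))%:R * f i <= N%:R * S + B.
  (* Truncation moves each weight by less than [1], hence the sum by at most [B]. *)
  rewrite /S /B mulr_sumr -big_split; apply: ler_sum => i _ /=.
  have : 0 <= N%:R * w i by rewrite mulr_ge0.
  move=> /truncn_itv /andP[t1 t2]; rewrite -natr1 in t2.
  have [f0|f0] := lerP 0 (f i); first by rewrite ger0_norm //; nra.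
  by rewrite ltr0_norm //; nra.
by nra.
Qed.

Lemma eventually_all (I : finType) (P : I -> nat -> Prop) :
  (forall i, exists N0, forall N, (N0 <= N)%N -> P i N) ->
  exists N, forall i, P i N.
Proof.
move=> H; have [N0 HN] := choice H; exists (\max_i N0 i) => i; apply: HN.
exact: leq_bigmax.
Qed.

Lemma linear_PoS_le {R : realType} {n m : nat} (b : 'I_m -> 'rV[R]_n) (T T' : tax_rule R n) :
  (forall j, positive (b j)) -> linear_rule b T' -> (forall j, T' (b j) = T (b j)) ->
  (PoS (games b T') <= PoS (games b T))%E.
Proof.
move=> b_pos lT' TT'.
have := PoS_ge0 (games_ge0 b_pos (T := T)) (games_inhabited b T).
case E : (PoS (games b T)) => [V||] //; last by move=> _; exact: leey.
rewrite lee_fin => V0; apply/(PoS_leP (games_ge0 b_pos (T := T')) V0) => G GT'.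
have [w w0 [scE ucE]] := wcostsP lT' GT'.
pose k N e j := Num.truncn (N%:R * w e j).
apply: contrapT => noeq.
(* A profile fails through a profitable deviation or by costing more than [V] times some [a']. Both
   are strict, so they survive rounding for large [N]; one [N] serves the finitely many profiles. *)
have [|N HN] := @eventually_all (profile G) (fun a N => ~ (wnash b T (fun e j => (k N e j)%:R) a /\
   forall a', feasible a' -> wsystem_cost b (fun e j => (k N e j)%:R) a <=
       V * wsystem_cost b (fun e j => (k N e j)%:R) a')); last first.
  have [|a na H] := copy_PoS (T := T) (k N) b_pos V0; first by rewrite E.
  by apply: (HN a).
move=> a; have [fa|nfa] := boolP (feasible a); last first.
  by exists 0%N => N _ [[fa _] _]; rewrite fa in nfa.
pose K N := fun e j => (k N e j)%:R : R.
have [na|] := boolP (is_pure_nash a).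
  have [a' fa' lt] : exists2 a' : profile G, feasible a' & V * system_cost a' < system_cost a.
    apply: contrapT => noa'; apply: noeq; exists a => // a' fa'.
    by rewrite leNgt; apply/negP => lt; apply: noa'; exists a'.
  pose f (p : resource G * 'I_m) := V * total_cost (b p.2) (load a' p.1)
                                    - total_cost (b p.2) (load a p.1).
  have scf (u : resource G -> 'I_m -> R) :
      V * wsystem_cost b u a' - wsystem_cost b u a = \sum_p u p.1 p.2 * f p.
    rewrite !wsystem_cost_pair mulr_sumr -sumrB.
    by apply: eq_bigr => p _; rewrite /f; ring.
  have [|N0 HN0] := @eventually_truncn_lt0 R _ (fun p => w p.1 p.2) f (fun p => w0 p.1 p.2).
    by rewrite -scf -!scE subr_lt0.
  exists N0 => N /HN0; rewrite -(scf (K N)) subr_lt0 => ltN [_ /(_ _ fa')].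
  by rewrite leNgt ltN.
rewrite /is_pure_nash fa /= => /forallPn[i /forall_inPn[s si]]; rewrite -ltNge => lt.
pose f (p : resource G * 'I_m) :=
  taxed b T' p.2 \at (load (deviate a i s) p.1) *+ (p.1 \in deviate a i s i)
  - taxed b T' p.2 \at (load a p.1) *+ (p.1 \in a i).
have ucf (u : resource G -> 'I_m -> R) :
    wuser_cost b T' u i (deviate a i s) - wuser_cost b T' u i a = \sum_p u p.1 p.2 * f p.
  by rewrite !wuser_cost_pair -sumrB; apply: eq_bigr => p _; rewrite mulrBr.
have [|N0 HN0] := @eventually_truncn_lt0 R _ (fun p => w p.1 p.2) f (fun p => w0 p.1 p.2).
  by rewrite -ucf -!ucE subr_lt0.
exists N0 => N /HN0; rewrite -(ucf (K N)) subr_lt0 => ltN [[_ /(_ _ _ si) na] _].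
have TE a1 : wuser_cost b T (K N) i a1 = wuser_cost b T' (K N) i a1.
  by rewrite !wuser_cost_pair; apply: eq_bigr => p _; rewrite /taxed TT'.
by move: na; rewrite -/(K N) !TE leNgt ltN.
Qed.

(** A Farkas lemma with natural multipliers: [nu] must be at least [- A i / B i] where [B i > 0] and
    at most that where [B i < 0]. Two indices at a time show these bounds compatible. *)
Lemma nonneg_combination {R : realType} (I : finType) (A B : I -> R) :
  (forall k : I -> nat, \sum_i (k i)%:R * B i <= 0 -> 0 <= \sum_i (k i)%:R * A i) ->
  exists2 nu, 0 <= nu & forall i, 0 <= A i + nu * B i.
Proof.
move=> H.
have single (f : I -> R) i t : \sum_l (t * (l == i))%:R * f l = t%:R * f i.
  rewrite (bigD1 i) //= eqxx muln1 big1 ?addr0 // => l /negPf ->.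
  by rewrite muln0 mul0r.
have H1 i : B i <= 0 -> 0 <= A i.
  move=> Bi; have := H (fun l => 1 * (l == i))%N.
  by rewrite !single !mul1r; exact.
have H2 i j : 0 < B i -> B j < 0 -> - (A i / B i) <= - (A j / B j).
  move=> Bi Bj; have Aj := H1 _ (ltW Bj).
  have [Ai|Ai] := lerP 0 (A i).
    apply: (@le_trans _ _ 0); first by rewrite oppr_le0 divr_ge0 // ltW.
    by rewrite oppr_ge0 mulr_ge0_le0 // invr_le0 ltW.
  (* The multipliers [q] and [1] cancel [B]. Truncating [N * q] keeps the combination of [B i] and
     [B j] nonpositive, and [N] tending to infinity removes the error. *)
  pose q := - B j / B i; have q0 : 0 < q by rewrite divr_gt0 ?oppr_gt0.
  have Hpq N : 0 <= (Num.truncn (N%:R * q))%:R * A i + N%:R * A j.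
    have := H (fun l => Num.truncn (N%:R * q) * (l == i) + N * (l == j))%N.
    have pair (f : I -> R) s t :
        \sum_l (s * (l == i) + t * (l == j))%:R * f l = s%:R * f i + t%:R * f j.
      by rewrite -!single -big_split; apply: eq_bigr => l _; rewrite natrD mulrDl.
    rewrite !pair.
    apply; have /truncn_itv/andP[t1 _] : 0 <= N%:R * q by rewrite mulr_ge0 // ltW.
    have : (Num.truncn (N%:R * q))%:R * B i <= N%:R * q * B i by rewrite ler_pM2r.
    by rewrite /q mulrA divfK ?gt_eqF //; lra.
  have Hq : 0 <= q * A i + A j.
    rewrite leNgt; apply/negP => lt0.
    set e := q * A i + A j in lt0.
    (* [N] is large enough that [N * e < A i], which outweighs the truncation error of at most
       [- A i]. *)
    have := Hpq (Num.truncn (A i / e)).+1; set N := (_.+1); set t := Num.truncn _.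
    have /truncn_itv/andP[_] : 0 <= N%:R * q by rewrite mulr_ge0 // ltW.
    rewrite -/t -natr1 => t2.
    have : A i / e < N%:R by exact: truncnS_gt.
    rewrite ltr_ndivrMr // => lt1.
    have : t%:R * A i < (N%:R * q - 1) * A i by rewrite ltr_nM2r //; lra.
    by rewrite /e in lt1 *; nra.
  have BiB : B i * B j < 0 by rewrite pmulr_rlt0.
  rewrite lerN2 -(ler_nM2r BiB).
  have -> : A i / B i * (B i * B j) = A i * B j by field; rewrite gt_eqF.
  have -> : A j / B j * (B i * B j) = A j * B i by field; rewrite lt_eqF.
  have : 0 <= (q * A i + A j) * B i by rewrite mulr_ge0 // ltW.
  by rewrite mulrDl mulrAC /q divfK ?gt_eqF //; lra.
pose nu := \big[Num.max/0]_(i | 0 < B i) - (A i / B i).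
exists nu => [|i]; first exact: bigmax_ge_id.
have [Bi|Bi|Bi] := ltrgtP (B i) 0.
- have : nu <= - (A i / B i).
    apply/bigmax_leP; split=> [|j Bj]; last exact: H2.
    by rewrite oppr_ge0 mulr_ge0_le0 ?invr_le0 ?H1 // ltW.
  by rewrite -mulNr ler_ndivlMr //; lra.
- have : - (A i / B i) <= nu by exact: le_bigmax_cond.
  by rewrite -mulNr ler_pdivrMr //; lra.
- by rewrite Bi mulr0 addr0 H1 // Bi.
Qed.

(** * The cyclic game *)

Lemma sum_ord_itv {R : realType} (N s e : nat) : (s <= e)%N -> (e <= N)%N ->
  \sum_(x < N) ((s <= x < e)%N)%:R = (e - s)%:R :> R.
Proof.
move=> se eN; rewrite -(big_mkord xpredT (fun x => ((s <= x < e)%N)%:R : R)).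
rewrite (big_cat_nat (leq0n s) (leq_trans se eN)) (big_cat_nat se eN) /=.
rewrite big_nat big1 ?add0r => [|x /andP[_ lt]]; last by rewrite leqNgt lt.
rewrite [X in _ + X]big_nat [X in _ + X]big1 ?addr0 => [|x /andP[le _]]; last first.
  by rewrite ltnNge le andbF.
rewrite big_nat (eq_bigr (fun=> 1)) => [|x ->] //.
by rewrite -big_nat big_const_nat iter_addr_0.
Qed.

Section CyclicGame.
Context {R : realType} {n m : nat} (b : 'I_m -> 'rV[R]_n.+1) (T : tax_rule R n.+1).
Hypothesis b_pos : forall j, positive (b j).

(* [(u, v, z)], as in [lp_gap]. *)
Definition triple := ('I_n.+2 * 'I_n.+2 * 'I_n.+2)%type.
Definition valid (t : triple) := (t.1.1 + t.1.2 + t.2 <= n.+1)%N.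

(* For each triple there is one resource per rotation of the users around a
   circle: the [u + z] first positions use it at equilibrium, the positions
   from [u] to [u + z + v] use it in the optimum. *)
Definition cyclic_resource : finType := (triple * 'I_n.+1)%type.

(** The difference is taken modulo [n + 1], so [r] rotates the circle of users. *)
Definition position (i r : 'I_n.+1) : nat := ((i - r)%R : 'I_n.+1).
Arguments position : simpl never.

Definition nash_action (i : 'I_n.+1) : {set cyclic_resource} :=
  [set p : cyclic_resource | (position i p.2 < p.1.1.1 + p.1.2)%N]%SET.

Definition opt_action (i : 'I_n.+1) : {set cyclic_resource} :=
  [set p : cyclic_resource |
     (p.1.1.1 <= position i p.2 < p.1.1.1 + p.1.1.2 + p.1.2)%N]%SET.

Lemma cyclic_user_le : (#|'I_n.+1| <= n.+1)%N.
Proof. by rewrite card_ord. Qed.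

Lemma cyclic_actions_neq0 (i : 'I_n.+1) :
  exists s, s \in [set nash_action i; opt_action i]%SET.
Proof. by exists (nash_action i); rewrite !inE eqxx. Qed.

Definition cyclic_game : congestion_game R n.+1 :=
  CongestionGame cyclic_user_le cyclic_actions_neq0 (fun=> 0) (fun=> 0).

Let a : profile cyclic_game := [ffun i => nash_action i].
Let a' : profile cyclic_game := [ffun i => opt_action i].

Lemma sum_position_resource (f : nat -> R) i : \sum_r f (position i r) = \sum_(x < n.+1) f x.
Proof. by rewrite [RHS](reindex_inj (@subrI _ i)). Qed.

Lemma sum_position_user (f : nat -> R) r : \sum_i f (position i r) = \sum_(x < n.+1) f x.
Proof. by rewrite [RHS](reindex_inj (@subIr _ r)). Qed.

Lemma sum_cyclic (f : triple * 'I_n.+1 -> R) :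
  \sum_(p : resource cyclic_game) f p = \sum_t \sum_r f (t, r).
Proof. by rewrite pair_bigA; apply: eq_bigr => -[]. Qed.

Lemma loadE (c : profile cyclic_game) e : (load c e)%:R = \sum_i (e \in c i)%:R :> R.
Proof.
by rewrite /load -sum1_card natr_sum big_mkcond; apply: eq_bigr => i _; rewrite inE; case: ifP.
Qed.

Lemma load_nash t r : valid t -> load a (t, r) = (t.1.1 + t.2)%N.
Proof.
move=> vt; apply/eqP; rewrite -(eqr_nat R) loadE.
rewrite (eq_bigr (fun i : 'I_n.+1 => (position i r < t.1.1 + t.2)%N%:R)); last first.
  by move=> i _; rewrite ffunE inE.
rewrite (sum_position_user (fun x => (x < t.1.1 + t.2)%N%:R)).
rewrite (eq_bigr (fun x : 'I_n.+1 => (0 <= x < t.1.1 + t.2)%N%:R)) //.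
by rewrite sum_ord_itv ?subn0 //; move: vt; rewrite /valid; lia.
Qed.

Lemma load_opt t r : valid t -> load a' (t, r) = (t.1.2 + t.2)%N.
Proof.
move=> vt; apply/eqP; rewrite -(eqr_nat R) loadE.
rewrite (eq_bigr (fun i : 'I_n.+1 =>
   (t.1.1 <= position i r < t.1.1 + t.1.2 + t.2)%N%:R)); last first.
  by move=> i _; rewrite ffunE inE.
rewrite (sum_position_user (fun x => (t.1.1 <= x < t.1.1 + t.1.2 + t.2)%N%:R)).
rewrite sum_ord_itv //; last by rewrite -addnA leq_addr.
by rewrite -addnA addKn.
Qed.

Lemma load_dev t (r i : 'I_n.+1) : valid t ->
  (t, r) \in opt_action i ->
  load (deviate a i (opt_action i)) (t, r) =
    if (position i r < t.1.1 + t.2)%N then (t.1.1 + t.2)%N else (t.1.1 + t.2).+1.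
Proof.
move=> vt io; rewrite load_deviate io.
have := load_others a i (t, r); rewrite (load_nash r vt) ffunE inE /=.
by case: ifP => _ ->; rewrite ?addn0 ?addn1.
Qed.

Variable k : 'I_m * triple -> nat.

(** Equal weights on all rotations of a triple make the users interchangeable; invalid triples get
    weight [0]. *)
Let w (p : resource cyclic_game) (j : 'I_m) : nat := (k (j, p.1) * valid p.1)%N.

Definition nash_gap j (t : triple) : R :=
  taxed b T j \at (t.1.1 + t.2) * (t.1.1 : nat)%:R
  - taxed b T j \at (t.1.1 + t.2).+1 * (t.1.2 : nat)%:R.

(** Over the rotations a user takes each position once, hence one of the first [u + z] in exactly
    [u + z] of them. *)
Lemma wuser_nash i : wuser_cost b T (fun p j => (w p j)%:R) i a =
  \sum_t \sum_j (k (j, t) * valid t)%:R * (taxed b T j \at (t.1.1 + t.2) * (t.1.1 + t.2)%:R).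
Proof.
rewrite /wuser_cost big_mkcond sum_cyclic /=.
apply: eq_bigr => t _; have [vt|nvt] := boolP (valid t); last first.
  rewrite big1 ?big1 // => [j _|r _]; first by rewrite muln0 mul0r.
  by case: ifP => // _; rewrite big1 // => j _; rewrite /w (negPf nvt) muln0 mul0r.
rewrite (eq_bigr (fun r => \sum_j (k (j, t))%:R *
    taxed b T j \at (t.1.1 + t.2) * (0 <= position i r < t.1.1 + t.2)%N%:R)).
  rewrite exchange_big /=; apply: eq_bigr => j _; rewrite -mulr_sumr muln1.
  rewrite (sum_position_resource (fun x => (0 <= x < t.1.1 + t.2)%N%:R)).
  by rewrite sum_ord_itv ?subn0 ?mulrA //; move: vt; rewrite /valid; lia.
move=> r _; rewrite ffunE inE /= load_nash //; case: ifP => h.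
  by apply: eq_bigr => j _; rewrite /w vt muln1 mulr1.
by rewrite big1 // => j _; rewrite mulr0.
Qed.

(** Of the [v + z] positions of the optimum, the [z] ones before [u + z] keep the load [u + z]; the
    other [v] see [u + z + 1]. *)
Lemma wuser_opt i :
  wuser_cost b T (fun p j => (w p j)%:R) i (deviate a i (opt_action i)) =
  \sum_t \sum_j (k (j, t) * valid t)%:R * (taxed b T j \at (t.1.1 + t.2) * (t.2 : nat)%:R
     + taxed b T j \at (t.1.1 + t.2).+1 * (t.1.2 : nat)%:R).
Proof.
set d := deviate a i (opt_action i).
rewrite /wuser_cost big_mkcond sum_cyclic /=.
apply: eq_bigr => t _; have [vt|nvt] := boolP (valid t); last first.
  rewrite big1 ?big1 // => [j _|r _]; first by rewrite muln0 mul0r.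
  by case: ifP => // _; rewrite big1 // => j _; rewrite /w (negPf nvt) muln0 mul0r.
rewrite (eq_bigr (fun r => \sum_j (k (j, t))%:R * (
    taxed b T j \at (t.1.1 + t.2) * (t.1.1 <= position i r < t.1.1 + t.2)%N%:R +
    taxed b T j \at (t.1.1 + t.2).+1 *
      (t.1.1 + t.2 <= position i r < t.1.1 + t.1.2 + t.2)%N%:R))).
  rewrite exchange_big /=; apply: eq_bigr => j _; rewrite -mulr_sumr muln1.
  rewrite big_split /= -!mulr_sumr.
  rewrite (sum_position_resource (fun x => (t.1.1 <= x < t.1.1 + t.2)%N%:R)).
  rewrite (sum_position_resource (fun x => (t.1.1 + t.2 <= x < t.1.1 + t.1.2 + t.2)%N%:R)).
  move: vt; rewrite /valid => vt.
  rewrite !sum_ord_itv //; do ?[lia].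
  by rewrite addKn; congr (_ * (_ + _ * _%:R)); lia.
move=> r _; rewrite {1}/d ffunE eqxx; case: ifP => h.
  rewrite load_dev //; apply: eq_bigr => j _; rewrite /w vt muln1; congr (_ * _).
  move: h; rewrite inE /= => /andP[h1 h2].
  rewrite h1 h2 andbT /= [(t.1.1 + t.2 <= _)%N]leqNgt.
  by case: ifP => _ /=; rewrite !(mulr0, mulr1, addr0, add0r).
rewrite big1 // => j _; move: h; rewrite inE /= => h.
have -> : (t.1.1 <= position i r < t.1.1 + t.2)%N = false.
  by apply: contraFF h => /andP[h1 h2]; apply/andP; split; lia.
have -> : (t.1.1 + t.2 <= position i r < t.1.1 + t.1.2 + t.2)%N = false.
  by apply: contraFF h => /andP[h1 h2]; apply/andP; split; lia.
by rewrite !mulr0 addr0 mulr0.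
Qed.

Lemma wsystem_cyclic (c : profile cyclic_game) (l : triple -> nat) :
  (forall t r, valid t -> load c (t, r) = l t) ->
  wsystem_cost b (fun p j => (w p j)%:R) c =
  n.+1%:R * \sum_t \sum_j (k (j, t) * valid t)%:R * total_cost (b j) (l t).
Proof.
move=> H; rewrite /wsystem_cost sum_cyclic mulr_sumr.
apply: eq_bigr => t _; rewrite (eq_bigr (fun=> \sum_j (k (j, t) * valid t)%:R *
  total_cost (b j) (l t))); first by rewrite sumr_const card_ord mulr_natl.
move=> r _; apply: eq_bigr => j _; rewrite /w /=.
by have [vt|nvt] := boolP (valid t); [rewrite H | rewrite muln0 !mul0r].
Qed.

(** The premise says that no user gains by moving to its optimal action. The bound on the price then
    compares the two profiles, up to the common factor [n + 1]. *)
Lemma cyclic_PoA (V : R) : 0 <= V -> (PoA (games b T) <= V%:E)%E ->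
  \sum_p (k p)%:R * (nash_gap p.1 p.2 *+ valid p.2) <= 0 ->
  0 <= \sum_p (k p)%:R * ((V * total_cost (b p.1) (p.2.1.2 + p.2.2)
            - total_cost (b p.1) (p.2.1.1 + p.2.2)) *+ valid p.2).
Proof.
move=> V0 PV gap.
have swap (f : 'I_m -> triple -> R) : \sum_p (k p)%:R * (f p.1 p.2 *+ valid p.2) =
    \sum_t \sum_j (k (j, t) * valid t)%:R * f j t.
  rewrite exchange_big pair_bigA /=; apply: eq_bigr => -[j t] _ /=.
  by case: (valid t); rewrite ?muln1 // muln0 mulr0 mul0r.
rewrite (swap nash_gap) in gap.
rewrite (swap (fun j t => V * total_cost (b j) (t.1.2 + t.2)
            - total_cost (b j) (t.1.1 + t.2))).
have na : wnash b T (fun p j => (w p j)%:R) a.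
  split; first by apply/forallP => i; rewrite ffunE !inE eqxx.
  move=> i s; rewrite !inE => /orP[/eqP ->|/eqP ->].
    by have := deviate_id a i; rewrite ffunE => ->.
  rewrite wuser_nash wuser_opt -subr_le0 -sumrB; apply: le_trans gap.
  rewrite le_eqVlt; apply/orP; left; apply/eqP; apply: eq_bigr => t _.
  rewrite -sumrB; apply: eq_bigr => j _; rewrite /nash_gap natrD; ring.
have fa' : feasible a' by apply/forallP => i; rewrite ffunE !inE eqxx orbT.
have := copy_PoA b_pos V0 PV na fa'.
rewrite (wsystem_cyclic load_nash) (wsystem_cyclic load_opt) mulrCA ler_pM2l ?ltr0n //.
rewrite -subr_ge0 mulr_sumr -sumrB; congr (_ <= _); apply: eq_bigr => t _.
by rewrite mulr_sumr -sumrB; apply: eq_bigr => j _; ring.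
Qed.

End CyclicGame.

(** A converse of [linear_PoA_le] for arbitrary rules: the cyclic games, over all multiplicities,
    supply the premise of [nonneg_combination]. *)
Lemma PoA_dual {R : realType} {n m : nat} (b : 'I_m -> 'rV[R]_n) (T : tax_rule R n) (V : R) :
  (1 <= n)%N -> (forall j, positive (b j)) -> 0 <= V -> (PoA (games b T) <= V%:E)%E ->
  exists2 nu, 0 <= nu & forall j u v z, (u + v + z <= n)%N ->
     0 <= V * total_cost (b j) (v + z) - total_cost (b j) (u + z)
       + nu * (taxed b T j \at (u + z) * u%:R - taxed b T j \at (u + z).+1 * v%:R).
Proof.
case: n b T => // n b T _ b_pos V0 PV.
have [nu nu0 H] := nonneg_combination (fun k => cyclic_PoA b_pos (T := T) (k := k) V0 PV).
exists nu => // j u v z le.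
have un : (u < n.+2)%N by lia.
have vn : (v < n.+2)%N by lia.
have zn : (z < n.+2)%N by lia.
have := H (j, (Ordinal un, Ordinal vn, Ordinal zn)).
by rewrite /valid /nash_gap /= le.
Qed.

(** * The pinned game *)

(** Independence of the basis makes coordinates well defined, and [pinvmx] computes them. *)
Lemma linear_extension {R : realType} {n m : nat} (b : 'I_m -> 'rV[R]_n) (T : tax_rule R n) :
  row_free (\matrix_(j < m) b j) ->
  exists2 T' : tax_rule R n, linear_rule b T' & forall j, T' (b j) = T (b j).
Proof.
set B := \matrix_j b j => freeB.
pose T' (l : 'rV[R]_n) := comb (fun j => (l *m pinvmx B) ord0 j) (fun j => T (b j)).
have combE (alpha : 'I_m -> R) : T' (comb alpha b) = comb alpha (fun j => T (b j)).
  have -> : comb alpha b = (\row_j alpha j) *m B.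
    rewrite mulmx_sum_row; apply: eq_bigr => j _; by rewrite mxE rowK.
  by rewrite /T' mulmxKp //; apply: eq_bigr => j _; rewrite mxE.
have TE j : T' (b j) = T (b j).
  by rewrite -[b j in LHS]scale1r -comb_delta combE comb_delta scale1r.
exists T' => // alpha _; rewrite combE.
by apply: eq_bigr => j _; rewrite TE.
Qed.

Lemma linear_rule_scale {R : realType} {n m : nat} (b : 'I_m -> 'rV[R]_n) (T : tax_rule R n) j q :
  linear_rule b T -> 0 <= q ->
  cone b (q *: b j) /\ T (q *: b j) = q *: T (b j).
Proof.
move=> lT q0; have a0 i : 0 <= q * (i == j)%:R by rewrite mulr_ge0.
split; last by rewrite -comb_delta lT // comb_delta.
by exists (fun i => q * (i == j)%:R); rewrite ?comb_delta.
Qed.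

Lemma count_lt n z : (z <= n)%N -> #|[pred i : 'I_n | (i < z)%N]| = z.
Proof.
move=> le; rewrite -sum1_card -[RHS]card_ord -sum1_card.
by rewrite (big_ord_widen n (fun=> 1%N) le); apply: eq_bigl => i; rewrite inE.
Qed.

Section PinnedUsers.
Context {R : realType} {n m : nat} (b : 'I_m -> 'rV[R]_n) (T : tax_rule R n).
Hypothesis n_ge1 : (1 <= n)%N.
Hypothesis b_pos : forall j, positive (b j).
Hypothesis lT : linear_rule b T.
Variables (j : 'I_m) (z : nat) (eps : R).
Hypothesis z_lt : (z < n)%N.
Hypothesis eps_gt0 : 0 < eps.
Let F : 'rV[R]_n := taxed b T j.
Hypothesis F_mono : nondecreasing_rf F.
Hypothesis F1 : F \at 1 = b j \at 1.

(* The first [z] users are pinned to the shared resource [None]; user [i >= z]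
   may leave it for the private resource [Some i], whose weight makes leaving
   unprofitable whatever the others do. *)
Definition private_weight : R := (F \at n + eps) / b j \at 1.

Definition pinned_actions (i : 'I_n) : {set {set option 'I_n}} :=
  if (i < z)%N then [set [set None]]%SET else [set [set None]; [set Some i]]%SET.

Lemma pinned_user_le : (#|'I_n| <= n)%N. Proof. by rewrite card_ord. Qed.

Lemma None_pinned i : [set None]%SET \in pinned_actions i.
Proof. by rewrite /pinned_actions; case: ifP => _; rewrite !inE eqxx. Qed.

Lemma pinned_actions_neq0 i : exists s, s \in pinned_actions i.
Proof. by exists [set None]%SET; exact: None_pinned. Qed.

Definition pinned_cost (e : option 'I_n) : 'rV[R]_n :=
  if e is Some _ then private_weight *: b j else b j.

Definition pinned_game : congestion_game R n :=
  CongestionGame pinned_user_le pinned_actions_neq0 pinned_cost (fun e => T (pinned_cost e)).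

Let b1_gt0 : 0 < b j \at 1. Proof. exact: b_pos. Qed.

Lemma private_weight_gt0 : 0 < private_weight.
Proof.
rewrite divr_gt0 // ltr_wpDl //; apply: le_trans (F_mono _ n_ge1 _) => //.
by rewrite F1 ltW.
Qed.

Lemma pinned_game_in : games b T pinned_game.
Proof.
case=> [i|] /=; split=> //; first exact: (linear_rule_scale j lT (ltW private_weight_gt0)).1.
by have := (linear_rule_scale j lT (@ler01 R)).1; rewrite scale1r.
Qed.

Lemma pinned_taxed (e : resource pinned_game) : rcost e + rtax e =
  if (e : option 'I_n) is Some _ then private_weight *: F else F.
Proof.
case: e => [i|] //=.
by rewrite (linear_rule_scale j lT (ltW private_weight_gt0)).2 /F /taxed scalerDr.
Qed.

(** A user on its private resource is alone there and pays [F n + eps], since [F 1 = b 1]; on the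
    shared resource it would pay at most [F n]. *)
Lemma pinned_nash (a : profile pinned_game) : is_pure_nash a -> forall i, a i = [set None]%SET.
Proof.
move=> /andP[/forallP fa /forallP na] i; have := fa i; rewrite /= /pinned_actions.
case: ifP => [_|_]; first by rewrite inE => /eqP.
rewrite !inE => /orP[/eqP //|/eqP ai].
have /forall_inP/(_ _ (None_pinned i)) := na i.
rewrite /user_cost ffunE eqxx ai !big_set1 -!value_atD !(@pinned_taxed (Some i)) (@pinned_taxed None).
have load1 : load a (Some i) = 1%N.
  rewrite /load (cardD1 i) inE ai inE eqxx; congr (_ + _)%N.
  apply: eq_card0 => l; rewrite !inE; apply/negP => /andP[li].
  have := fa l; rewrite /= /pinned_actions; case: ifP => _.
    by rewrite inE => /eqP ->; rewrite inE.
  rewrite !inE => /orP[/eqP ->|/eqP ->]; rewrite inE // => /eqP[e].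
  by rewrite e eqxx in li.
have loadn : (1 <= load (deviate a i [set None]%SET) (None : resource pinned_game) <= n)%N.
  rewrite {1}load_deviate inE eqxx addn1 /=.
  by rewrite /load (leq_trans (max_card _)) // card_ord.
rewrite load1 value_atZ F1 /private_weight divfK ?gt_eqF //.
move: loadn => /andP[l1 ln] h; have := le_trans h (F_mono l1 ln (leqnn n)).
by rewrite gerDl leNgt eps_gt0.
Qed.

(** The only equilibrium is compared with the profile in which every unpinned user leaves. *)
Lemma pinned_PoS (V : R) : 0 <= V -> (PoS (games b T) <= V%:E)%E ->
  total_cost (b j) n <=
  V * (total_cost (b j) z + (n - z)%:R * (F \at n + eps)).
Proof.
move=> V0 /(PoS_leP (games_ge0 b_pos (T := T)) V0)/(_ _ pinned_game_in)[a na H].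
have aN := pinned_nash na.
pose a' : profile pinned_game := [ffun i : 'I_n => if (i < z)%N then [set None]%SET else [set Some i]%SET].
have fa' : feasible a'.
  apply/forallP => i; rewrite ffunE /= /pinned_actions.
  by case: ifP => _; rewrite !inE eqxx // orbT.
have := H _ fa'; congr (_ <= V * _).
  rewrite /system_cost (eq_bigr (fun=> b j \at n)); last first.
    move=> i _; rewrite aN big_set1 /=; congr (_ \at _).
    by rewrite /load -[RHS]card_ord; apply: eq_card => l; rewrite !inE aN inE.
  by rewrite sumr_const card_ord /total_cost mulr_natr.
rewrite /system_cost (bigID (fun i : 'I_n => i < z)%N) /=; congr (_ + _).
  rewrite (eq_bigr (fun=> b j \at z)); last first.
    move=> i iz; rewrite ffunE iz big_set1 /=; congr (_ \at _).
    rewrite /load -[RHS](count_lt (ltnW z_lt)); apply: eq_card => l.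
    by rewrite !inE ffunE; case: ifP => _; rewrite inE.
  by rewrite sumr_const count_lt ?(ltnW z_lt) // /total_cost mulr_natr.
rewrite (eq_bigr (fun=> F \at n + eps)) => [|i /negPf iz].
  rewrite sumr_const mulr_natl; congr (_ *+ _).
  have := cardC [pred i : 'I_n | (i < z)%N].
  rewrite count_lt ?(ltnW z_lt) // card_ord => e.
  by rewrite -[X in _ = (X - z)%N]e addKn; apply: eq_card.
rewrite ffunE iz big_set1 /= value_atZ.
have -> : load a' (Some i) = 1%N.
  rewrite /load -(card1 (i : 'I_n)); apply: eq_card => l; rewrite !inE ffunE.
  case: ifP => lz; rewrite inE; last by rewrite eq_sym.
  by apply/esym/negP => /eqP e; rewrite -e lz in iz.
by rewrite /private_weight divfK ?gt_eqF.
Qed.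

End PinnedUsers.

(** * Comparison of rules and conclusion *)

Lemma linear_improvement {R : realType} {n m : nat} (b : 'I_m -> 'rV[R]_n) (T : tax_rule R n) :
  (1 <= n)%N -> row_free (\matrix_(j < m) b j) -> (forall j, positive (b j)) ->
  exists T', [/\ linear_rule b T', (PoA (games b T') <= PoA (games b T))%E &
                 (PoS (games b T') <= PoS (games b T))%E].
Proof.
move=> n1 freeb b_pos; have [T' lT' TE] := linear_extension T freeb.
exists T'; split=> //; last exact: linear_PoS_le.
have := le_trans (PoS_ge0 (games_ge0 b_pos (T := T)) (games_inhabited b T))
                 (PoS_le_PoA (games b T)).
case E : (PoA (games b T)) => [V||] //; last by move=> _; exact: leey.
rewrite lee_fin => V0; have [|nu nu0 H] := PoA_dual (T := T) n1 b_pos V0; first by rewrite E.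
apply: (linear_PoA_le b_pos lT' V0 nu0) => j u v z le.
by rewrite /taxed TE; exact: H.
Qed.

Lemma rule_of_linear {R : realType} {n m : nat} (b F : 'I_m -> 'rV[R]_n) (T : tax_rule R n) :
  rule_of b F T -> linear_rule b T /\ forall j, taxed b T j = F j.
Proof.
move=> rT; have TE j : T (b j) = F j - b j.
  have a0 i : 0 <= 1 * (i == j)%:R :> R by rewrite mul1r.
  by have := rT _ a0; rewrite !comb_delta !scale1r.
split=> [alpha a0|j]; last by rewrite /taxed TE addrC subrK.
by rewrite rT //; apply: eq_bigr => j _; rewrite TE.
Qed.

(** The constraints of the program times [V] are those of [linear_PoA_le] with [nu = V], once
    [V * rho j] is lowered to [1]. *)
Lemma lp_optimum_PoA {R : realType} {n m : nat} (b F : 'I_m -> 'rV[R]_n) (rho : 'I_m -> R)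
    (T : tax_rule R n) (V : R) :
  (forall j, positive (b j)) -> (forall j, lp_feasible (b j) (F j) (rho j)) ->
  rule_of b F T -> 0 <= V -> (forall j, 1 <= V * rho j) -> (PoA (games b T) <= V%:E)%E.
Proof.
move=> b_pos fF rT V0 Vrho; have [lT TE] := rule_of_linear rT.
apply: (linear_PoA_le b_pos lT V0 V0) => j u v z le; rewrite TE.
have /lp_feasible_feas/(_ _ _ _ le) := fF j; rewrite /lp_gap => h.
have := mulr_ge0 V0 h; have := Vrho j; have := total_basis_ge0 b_pos j (u + z)%N.
by nra.
Qed.

Theorem theorem1 (R : realType) (n m : nat) (b : 'I_m -> 'rV[R]_n)
    (n_ge1 : (1 <= n)%N)
    (b_basis : row_free (\matrix_(j < m) b j))
    (b_pos : forall j, positive (b j))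
    (b_nondecreasing : forall j, nondecreasing_rf (b j))
    (b_convex : forall j, convex_rf (b j)) :
  (forall Tlin : tax_rule R n,
     pareto_optimal b (linear_rule b) Tlin -> pareto_optimal b [set: tax_rule R n] Tlin)
  /\
  (forall (F : 'I_m -> 'rV[R]_n) (rho : 'I_m -> R) (TPoA : tax_rule R n),
     (forall j, lp_solution (b j) (F j) (rho j)) ->
     rule_of b F TPoA ->
     [/\ forall T : tax_rule R n, (PoA (games b TPoA) <= PoA (games b T))%E,
         PoS (games b TPoA) = PoA (games b TPoA),
         forall j, nondecreasing_rf (F j) &
         forall j (F' : 'rV[R]_n) (rho' : R), lp_solution (b j) F' rho' ->
           exists2 c : R, 0 < c & F' = c *: F j]).
Proof.
split.
  move=> Tlin [linT opt]; split=> // -[T [_ PoAle PoSle strict]]; apply: opt.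
  have [T' [lT' PoA' PoS']] := linear_improvement T n_ge1 b_basis b_pos.
  exists T'; split=> //; [exact: le_trans PoAle | exact: le_trans PoSle |].
  by case: strict => lt; [left; exact: le_lt_trans lt | right; exact: le_lt_trans lt].
move=> F rho TPoA solF rT; have [lT TE] := rule_of_linear rT.
have fF j := (solF j).1.
have cost0 j : total_cost (b j) 0 = 0 by rewrite /total_cost mulr0.
have opt j (F' : 'rV[R]_n) r : lp_solution (b j) F' r ->
    optimal n (total_cost (b j)) (value_at F') r by exact: lp_solution_optimal.
have struct j := optimal_structure n_ge1 (cost0 j) (total_cost1_gt0 n_ge1 (b_pos j))
  (total_cost_convex (b_nondecreasing j) (b_convex j)) (opt j _ _ (solF j)).
have ge0 T := games_ge0 b_pos (T := T).
have PoS0 T := PoS_ge0 (ge0 T) (games_inhabited b T).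
split.
- move=> T; have := le_trans (PoS0 T) (PoS_le_PoA _).
  case E : (PoA (games b T)) => [V||] //; last by move=> _; exact: leey.
  rewrite lee_fin => V0; apply: (lp_optimum_PoA b_pos fF rT V0) => j.
  have [|nu nu0 H] := PoA_dual (T := T) n_ge1 b_pos V0; first by rewrite E.
  have b1 := total_cost1_gt0 n_ge1 (b_pos j).
  have V1 : 0 < V.
    have := H j 0%N 0%N 1%N; rewrite !add0n !mulr0 subrr mulr0 addr0 => /(_ n_ge1) h.
    by nra.
  (* Dividing the dual certificate by [V] gives a feasible point of the program with value [1 / V],
     so [1 / V <= rho j]. *)
  suff /(solF j).2 : lp_feasible (b j) ((nu / V) *: taxed b T j) V^-1.
    by rewrite -ler_pdivrMl // mulr1.
  apply/lp_feasible_feas => u v z le; rewrite /lp_gap !value_atZ.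
  have := H j u v z le; rewrite -(pmulr_rge0 _ (_ : 0 < V^-1)) ?invr_gt0 //.
  by congr (_ <= _); field; rewrite gt_eqF.
- apply/le_anti; rewrite (PoS_le_PoA (games b TPoA)) /=.
  have := PoS0 TPoA; case E : (PoS (games b TPoA)) => [V||] //; last by move=> _; exact: leey.
  rewrite lee_fin => V0; apply: (lp_optimum_PoA b_pos fF rT V0) => j.
  have [F1 Fmono [z zn tight] _] := struct j.
  have cn : 0 < total_cost (b j) n by rewrite mulr_gt0 ?ltr0n // b_pos // n_ge1 leqnn.
  rewrite -(ler_pM2r cn) mul1r; apply/ler_addgt0Pr => e e0.
  (* The surcharge [d] on leaving is chosen so that its total effect [V * (n - z) * d] stays below
     [e]. *)
  pose d := e / (V * n%:R + 1).
  have Vn : 0 < V * n%:R + 1 by rewrite ltr_wpDl // mulr_ge0.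
  have d0 : 0 < d by rewrite divr_gt0.
  have FE : taxed b TPoA j \at 1 = b j \at 1 by rewrite TE F1 /total_cost mulr1.
  have Fm : nondecreasing_rf (taxed b TPoA j) by rewrite TE => x y x0 xy yn; exact: Fmono.
  have := pinned_PoS n_ge1 b_pos lT zn d0 Fm FE V0; rewrite E TE => /(_ (lexx _)) h.
  apply: le_trans h _.
  have -> : total_cost (b j) z + (n - z)%:R * (F j \at n + d) =
            rho j * total_cost (b j) n + (n - z)%:R * d by rewrite -tight; ring.
  rewrite mulrDr mulrA lerD2l.
  have nz : ((n - z)%:R : R) <= n%:R by rewrite ler_nat leq_subr.
  have -> : e = (V * n%:R + 1) * d by rewrite /d mulrC divfK ?gt_eqF.
  by rewrite mulrA ler_pM2r // (le_trans (ler_wpM2l V0 nz)) // lerDl.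
- by move=> j x y x0 xy yn; have [_ Fmono _ _] := struct j; exact: Fmono.
- move=> j F' r' sF'; exists 1 => //; rewrite scale1r.
  have [_ _ _ uniq] := struct j; apply: value_at_inj => x x0 xn.
  exact: (uniq _ _ (opt j _ _ sF')).
Qed.
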